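(* Let $D$ be a link diagram of an oriented link $L$. Let $s_0$ be a Kauffman state of $D$ such that all the blue scars in $s_0D$ are grouped into $k$ ladders $H_1,\dots,H_k$ of heights $h_i\ge2$, $i=1,\dots,k$. Suppose that: 1. There exists a ladder $H_l$ with periphery number one and height $h_l\ge3$. 2. All the red scars of $s_0D$ become bichords when all the ladders are broken (that is, they are bichords in $s_1D$, where $s_1$ is obtained from $s_0$ by changing into red one blue step of each ladder). Then there is an order two torsion element in the Khovanov homology of $L$. Precisely, assume that $H_1,\dots,H_t$ ($t\le k$) are the blue ladders with periphery number one. If $\mu_1,\dots,\mu_t$ are integers with $2\le\mu_i\le h_i$, $i=1,\dots,t$, and there exists $r\in\{1,\dots,t\}$ such that $\mu_r$ is even and $\mu_r<h_r$, then, setting $\mu_i=h_i$ for $t<i\le k$, the class $[V]$ of the chain $$V=V(\mu_1,\dots,\mu_t,h_{t+1},\dots,h_k)=\sum_{\substack{i\in\{1,\dots,k\}\\ \mu_i \text{ even},\ \mu_i<h_i}}(-1)^{\mu_1+\dots+\mu_{i-1}}\, s(\mu_1,\dots,\mu_{i-1},1+\mu_i,\mu_{i+1},\dots,\mu_k;C_i^{0-})$$ is an order two torsion element.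
   Context: Khovanov complex (coefficients in $\mathbb Z$). A Kauffman state of a diagram $D$ is a map $s:\mathrm{Cro}(D)\to\{A,B\}$ on the set of crossings. $sD$ denotes the collection of disjoint simple closed curves (''circles'') obtained by smoothing each crossing according to its label, where the $A$-smoothing joins the two regions swept by rotating the overstrand counterclockwise and the $B$-smoothing joins the other two; at each crossing one keeps a small chord (''scar'') joining the two resulting arcs, blue for an $A$-label and red for a $B$-label. A scar is a monochord if both endpoints lie on the same circle and a bichord if they lie on different circles. An enhanced state is a state together with a sign $\pm$ on each circle of $sD$; $\theta(s)=\#(+)-\#(-)$, $i(s)=$ number of $B$-labels, $j(s)=i(s)+\theta(s)$. $C^{i,j}(D)$ is the free module generated by enhanced states with $i(s)=i$, $j(s)=j$. An enhanced state $t$ is adjacent to $s$ if $i(t)=i(s)+1$, $j(t)=j(s)$, the labels agree except at one crossing $x$ where $s(x)=A$, $t(x)=B$, and the signs of the common circles agree (so mergings are $(+,+)\mapsto +$, $(+,-),(-,+)\mapsto -$, and splittings are $+\mapsto(+,-)$ or $(-,+)$, $-\mapsto(-,-)$). With the crossings numbered, $d(s)=\sum_t (-1)^{k(s,t)}t$ over all $t$ adjacent to $s$, where $k(s,t)$ is the number of crossings previous to the change crossing $x$ having a $B$-label in $s$. $\underline{Kh}^{i,j}(D)=\ker(d:C^{i,j}\to C^{i+1,j})/\mathrm{im}(d:C^{i-1,j}\to C^{i,j})$. If $D$ has $p$ positive and $n$ negative crossings, $Kh^{h,q}(L)=\underline{Kh}^{h+n,\,q-p+2n}(D)$. Ladders.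 A (blue) ladder of $s_0D$ of height $h\ge1$ is a maximal disc of $\mathbb R^2$ containing exactly two arcs (of the same circle or of different circles) and $h$ parallel blue scars (the steps) joining the two arcs; maximal means that no larger such disc contains an extra parallel blue scar. Cutting (breaking) a ladder means replacing the two arcs by two caps, one at each end of the ladder, as when changing a step to red. Cut all the ladders of $s_0D$; the one or two resulting circles touching the two ends of $H_i$ form the periphery of $H_i$, and their number (1 or 2) is the periphery number of $H_i$. Notation. The crossings of $D$ are ordered so that first come those of $H_1$ (in the order of its steps along the ladder), then those of $H_2$, etc., and finally the remaining ones. For subsets $M_i\subset\{1,\dots,h_i\}$ of sizes $\mu_i>0$, $s(M_1,\dots,M_k;\,)$ is the Kauffman state obtained from $s_0$ by changing the steps in $M_i$ of $H_i$ to red, for every $i$. In it, $C_i^j$ ($1\le j\le\mu_i-1$) is the intermediate circle between the $j$-th and $(j+1)$-th red steps of $H_i$, and $C_i^0$ is the periphery circle of $H_i$ touching the first red step of $M_i$ (if the periphery number is one it also touches the last one). $s(\mu_1,\dots,\mu_k;C_i^{j-})$ is the sum, over all $M_1,\dots,M_k$ with $|M_t|=\mu_t$, of the enhanced states with underlying state $s(M_1,\dots,M_k;\,)$ in which all circles have sign $+$ except $C_i^j$, which has sign $-$. *)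

(* Defs.v *)
(* Based on MathComp; [boolp] is only used to decide whether a chain is in the
   image of the differential. *)
From HB Require Import structures.
From mathcomp Require Import all_boot all_order all_algebra.
From mathcomp Require Import boolp.

Set Implicit Arguments.
Unset Strict Implicit.
Unset Printing Implicit Defensive.

Import Order.TTheory GRing.Theory Num.Theory.
Local Open Scope ring_scope.

(* ** Oriented link diagrams in the plane

   A diagram is encoded, up to isotopy of the plane, as a combinatorial map.
   The four half-edges at a crossing [x] are [(x, 0), ..., (x, 3)] in
   counterclockwise order, [(x, 0)] being the incoming half of the
   understrand (the PD-code convention), so that [(x, 0)], [(x, 2)] form the
   understrand and [(x, 1)], [(x, 3)] the overstrand.  A component [l] without
   crossings carries one marked point, with half-edges [(l, false)] and
   [(l, true)]. *)

Definition half_edge (X : finType) : finType := (X * 'Z_4)%type.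
Definition dart (X L : finType) : finType := (half_edge X + L * bool)%type.

Definition opposite (X : finType) (c : half_edge X) : half_edge X :=
  (c.1, c.2 + 2).

Section Map.
Variables (X L : finType).

Definition rot (a : dart X L) : dart X L :=
  match a with inl c => inl (c.1, c.2 + 1) | inr l => inr (l.1, ~~ l.2) end.

Definition unrot (a : dart X L) : dart X L :=
  match a with inl c => inl (c.1, c.2 - 1) | inr l => inr (l.1, ~~ l.2) end.

Definition edge (join : half_edge X -> half_edge X) (a : dart X L) : dart X L :=
  match a with inl c => inl (join c) | inr l => inr (l.1, ~~ l.2) end.

(* A dart [a] also names the corner between [a] and [rot a], which lies on
   the left when leaving along [a].  Following the boundary of a region with
   the region on the left leads from the corner [a] to the corner
   [boundary a]; the cycles of [boundary] are the boundary curves of the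
   complementary regions. *)
Definition boundary (join : half_edge X -> half_edge X) (a : dart X L) : dart X L :=
  unrot (edge join a).

(* The understrand goes from half-edge 0 to half-edge 2; at a positive
   crossing the overstrand goes from 3 to 1, at a negative one from 1 to 3. *)
Definition outgoing (pos : pred X) (c : half_edge X) : bool :=
  match val c.2 with
  | 0%N => false | 1%N => pos c.1 | 2%N => true | _ => ~~ pos c.1
  end.

End Map.

(* [region_of] tells in which region of the plane each corner lies; a region
   may have several boundary curves when the diagram is disconnected.  Gluing
   to the edges, for each region, a sphere with as many holes as it has
   boundary curves yields a closed surface, with Euler characteristic
   V - E + (sum over the regions of 2 - number of boundary curves); the last
   two axioms say that this surface is connected of characteristic 2, i.e.
   that it is the sphere.  The point at infinity lies in [outer]. *)
Record diagram := Diagram {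
  crossing : finType;
  free_circle : finType;
  region : finType;
  join : half_edge crossing -> half_edge crossing;
  positive : pred crossing;
  region_of : dart crossing free_circle -> region;
  outer : region;
  joinK : involutive join;
  join_outgoing : forall c, outgoing positive (join c) = ~~ outgoing positive c;
  region_of_boundary : forall a, region_of (boundary join a) = region_of a;
  region_of_surj : forall r, exists a, region_of a = r;
  diagram_connected : forall a b,
    connect [rel u v | [|| v == edge join u, v == rot u
                         | region_of u == region_of v]] a b;
  diagram_euler :
    ((#|crossing| + #|free_circle|) + 2 * #|region|
     = (2 * #|crossing| + #|free_circle|)
       + fcard (@boundary crossing free_circle join)
               (dart crossing free_circle) + 2)%N
}.

Section Khovanov.
Variable D : diagram.
Local Notation X := (crossing D).
Local Notation darts := (dart (crossing D) (free_circle D)).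

Definition n_positive : nat := #|[set x : X | positive x]|.
Definition n_negative : nat := #|[set x : X | ~~ positive x]|.

(* ** Kauffman states: [s x = true] iff the label of [x] is B (red). *)
Definition kstate : finType := {ffun X -> bool}.

(* Turning the overstrand {1, 3} counterclockwise sweeps the corners
   between 1, 2 and between 3, 0.  Hence the arcs of the A-smoothing join
   0 with 1 and 2 with 3, and those of the B-smoothing 1 with 2 and 3 with 0. *)
Definition smooth (s : kstate) (a : darts) : darts :=
  match a with
  | inl c => inl (c.1, if odd c.2 (+) s c.1 then c.2 - 1 else c.2 + 1)
  | inr l => inr (l.1, ~~ l.2)
  end.

(* Circles of [sD] are represented by their sets of darts. *)
Definition circle (s : kstate) (a : darts) : {set darts} :=
  [set b | connect [rel u v | (v == edge (@join D) u) || (v == smooth s u)] a b].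

Definition circles (s : kstate) : {set {set darts}} :=
  [set circle s a | a : darts].

(* With either label, one end of the scar at [x] is on the arc through the
   half-edge 0 and the other one on the arc through the half-edge 2. *)
Definition bichord (s : kstate) (x : X) : bool :=
  circle s (inl (x, 0)) != circle s (inl (x, 2)).

(* An enhanced state is a state with the set of its circles of sign +. *)
Definition estate : finType :=
  {e : kstate * {set {set darts}} | e.2 \subset circles e.1}.

Definition est (e : estate) : kstate := (val e).1.
Definition plus (e : estate) : {set {set darts}} := (val e).2.

Definition theta (e : estate) : int :=
  #|plus e|%:Z - #|circles (est e) :\: plus e|%:Z.
Definition ideg (e : estate) : int := #|[set x | est e x]|%:Z.
Definition jdeg (e : estate) : int := ideg e + theta e.

(* [t] is adjacent to [s], with change crossing [x]. *)
Definition adjacent_at (x : X) (s t : estate) : bool :=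
  [&& ~~ est s x, est t == [ffun y => (y == x) || est s y],
      ideg t == ideg s + 1, jdeg t == jdeg s
    & [forall c in circles (est s) :&: circles (est t),
         (c \in plus s) == (c \in plus t)]].

Definition chain : zmodType := {ffun estate -> int}.

(* A numbering of the crossings is an enumeration [num] of [X]. *)
Definition nb_before (num : seq X) (x : X) (s : kstate) : nat :=
  #|[set y | s y & (index y num < index x num)%N]|.

(* The linear extension of [s |-> sum of (-1)^k(s,t) t, t adjacent to s]. *)
Definition diff (num : seq X) (c : chain) : chain :=
  [ffun t => \sum_(x : X) \sum_(s | adjacent_at x s t)
               (-1) ^+ nb_before num x (est s) * c s].

Definition in_degree (i j : int) (c : chain) : bool :=
  [forall e, (c e != 0) ==> (ideg e == i) && (jdeg e == j)].

Definition cycle_pred (num : seq X) (i j : int) : {pred chain} :=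
  [pred c | in_degree i j c && (diff num c == 0)].

Lemma diffB num : {morph diff num : c c' / c - c'}.
Proof.
move=> c c'; apply/ffunP=> t; rewrite !ffunE -sumrB; apply: eq_bigr => x _.
by rewrite -sumrB; apply: eq_bigr => s _; rewrite !ffunE mulrBr.
Qed.

Lemma diff0 num : diff num 0 = 0.
Proof. by have := diffB num 0 0; rewrite !subrr. Qed.

Lemma in_degree0 i j : in_degree i j 0.
Proof. by apply/forallP=> e; apply/implyP; rewrite ffunE eqxx. Qed.

Lemma in_degreeB i j c c' :
  in_degree i j c -> in_degree i j c' -> in_degree i j (c - c').
Proof.
move=> /forallP hc /forallP hc'; apply/forallP=> e; apply/implyP => ne.
have [ce|ce] := eqVneq (c e) 0; last exact: (implyP (hc e)).
by apply: (implyP (hc' e)); move: ne; rewrite !ffunE ce sub0r oppr_eq0.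
Qed.

Lemma cycle_pred_closed num i j : zmod_closed (cycle_pred num i j).
Proof.
split=> [|c c' /andP[hc /eqP dc] /andP[hc' /eqP dc']].
  by rewrite inE in_degree0 diff0 eqxx.
by rewrite inE in_degreeB //= diffB dc dc' subrr.
Qed.

HB.instance Definition _ num i j :=
  GRing.isZmodClosed.Build chain (cycle_pred num i j)
    (cycle_pred_closed num i j).

Record cycles (num : seq X) (i j : int) := Cycle {
  cycle_chain :> chain;
  _ : cycle_chain \in cycle_pred num i j }.

HB.instance Definition _ num i j :=
  [isSub for @cycle_chain num i j].
HB.instance Definition _ num i j := [Choice of @cycles num i j by <:].
HB.instance Definition _ num i j :=
  [SubChoice_isSubZmodule of @cycles num i j by <:].

Definition boundary_pred (num : seq X) (i j : int) : {pred cycles num i j} :=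
  [pred z | `[< exists2 y : chain,
                 in_degree (i - 1) j y & diff num y = cycle_chain z >]].

Lemma boundary_pred_closed num i j : zmod_closed (@boundary_pred num i j).
Proof.
split=> [|z z' /asboolP[y hy dy] /asboolP[y' hy' dy']]; apply/asboolP.
  by exists 0; [exact: in_degree0 | rewrite diff0].
by exists (y - y'); [exact: in_degreeB | rewrite diffB dy dy'].
Qed.

HB.instance Definition _ num i j :=
  GRing.isZmodClosed.Build (cycles num i j) (@boundary_pred num i j)
    (@boundary_pred_closed num i j).

Definition boundaries (num : seq X) (i j : int) :
    zmodClosed (cycles num i j) :=
  GRing.ZmodClosed.clone _ (@boundary_pred num i j) _.

(* The unnormalized homology [ker d / im d] at [C^{i,j}(D)], and the class
   of a cycle in it. *)
Definition uKh (num : seq X) (i j : int) : zmodType :=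
  Quotient.quot (boundaries num i j).

Definition hclass (num : seq X) (i j : int) (z : cycles num i j) :
    uKh num i j :=
  (\pi_(Quotient.quot (boundaries num i j)) z)%qT.

Definition Kh (num : seq X) (h q : int) : zmodType :=
  uKh num (h + n_negative%:Z) (q - n_positive%:Z + 2 * n_negative%:Z).

(* ** Ladders

   A ladder is encoded by the sequence of its steps, read along the ladder;
   each step is given by the half-edge naming the corner through which one
   leaves its crossing towards the next step ([opposite] then names the
   corner through which one arrived).  The two corners of a crossing that are
   joined by the A-smoothing are those named by the half-edges 1 and 3.

   Two blue scars are consecutive in a disc containing nothing else than two
   arcs and parallel blue scars iff their crossings are the two corners of a
   bigon which is a whole bounded region of the complement of [D]. *)

Definition bigon (c e : half_edge X) : bool :=
  [&& boundary (@join D) (inl c : darts) == inl (opposite e),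
      boundary (@join D) (inl (opposite e) : darts) == inl c,
      region_of (inl c : darts) != outer D
    & [set a : darts | region_of a == region_of (inl c : darts)]
        == [set inl c; inl (opposite e)]].

Definition ladder_disc (s : kstate) (H : seq (half_edge X)) : bool :=
  [&& (0 < size H)%N, all (fun c : half_edge X => ~~ s c.1 && odd c.2) H,
      uniq (unzip1 H) & sorted bigon H].

Definition ladder (s : kstate) (H : seq (half_edge X)) : Prop :=
  ladder_disc s H /\
  forall pre post : seq (half_edge X),
    ladder_disc s (pre ++ H ++ post) -> pre = [::] /\ post = [::].

Section Ladders.
Variables (s0 : kstate) (k : nat) (H : 'I_k -> seq (half_edge X)).

(* The crossings of the ladders, in the order of the ladders and along each
   of them. *)
Definition ladder_crossings : seq X := flatten [seq unzip1 (H i) | i : 'I_k].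

(* All the blue scars of [s0] are grouped into the ladders [H i]. *)
Definition grouped : Prop :=
  (forall i, ladder s0 (H i)) /\
  perm_eq ladder_crossings (enum [pred x | ~~ s0 x]).

Definition step (i : 'I_k) (m : 'I_(size (H i))) : half_edge X :=
  tnth (in_tuple (H i)) m.

(* [cut i] is the step of [H i] which is changed to break it. *)
Variable cut : forall i : 'I_k, 'I_(size (H i)).

Definition s1 : kstate :=
  [ffun x => s0 x || [exists i, x == (step (cut i)).1]].

(* The number of circles touching the two ends of [H i] once all the ladders
   are broken. *)
Definition periphery_number (i : 'I_k) : nat :=
  #|[set circle s1 (inl (opposite (head (step (cut i)) (H i))));
         circle s1 (inl (last (step (cut i)) (H i)))]|.

(* A choice of subsets [M_i] of the sets of steps of the [H i]. *)
Definition steps_choice : finType :=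
  {dffun forall i : 'I_k, {set 'I_(size (H i))}}.

(* The state [s(M_1, ..., M_k; )]. *)
Definition sM (M : steps_choice) : kstate :=
  [ffun x => s0 x || [exists i, [exists m in M i, x == (step m).1]]].

(* The circle [C_i^0]: it touches the first red step of [H i] on the side of
   the beginning of the ladder.  When [H i] has no red step (never the case
   below), the value is irrelevant. *)
Definition C0 (s : kstate) (i : 'I_k) : {set darts} :=
  circle s (inl (opposite (head (step (cut i)) [seq c <- H i | s c.1]))).

(* The generator given by a state and the set of its circles of sign +. *)
Definition generator (s : kstate) (P : {set {set darts}}) : chain :=
  [ffun e => (val e == (s, P))%:R].

(* The chain [s(mu_1, ..., mu_k; C_i^{0-})]. *)
Definition s_minus (mu : 'I_k -> nat) (i : 'I_k) : chain :=
  \sum_(M : steps_choice | [forall l, #|M l| == mu l])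
     generator (sM M) (circles (sM M) :\ C0 (sM M) i).

Definition V (mu : 'I_k -> nat) : chain :=
  \sum_(i < k | ~~ odd (mu i) && (mu i < size (H i))%N)
     s_minus (fun l => (l == i) + mu l)%N i
       *~ ((-1) ^+ (\sum_(l < k | (l < i)%N) mu l)%N).

End Ladders.
End Khovanov.

Definition order_two (A : zmodType) (x : A) : Prop := x != 0 /\ x *+ 2 = 0.

(* Main.v *)
Require Import Defs.
From HB Require Import structures.
From mathcomp Require Import all_boot all_order all_algebra.
From mathcomp Require Import boolp zify.

Set Implicit Arguments.
Unset Strict Implicit.
Unset Printing Implicit Defensive.

Import Order.TTheory GRing.Theory Num.Theory.
Local Open Scope ring_scope.

(** Read the sign + of a circle C as 1 and the sign - as X_C, with X_C^2 = 0.
    When the crossing x splits a circle into A and B, the differential then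
    multiplies by X_A + X_B.

    Consider the states s(M) in which every ladder has a red step.  Their blue
    crossings are steps of ladders that are already broken, and changing such a
    step to red splits a circle ([all_split_sM]).  So the differential of s(M)
    with all signs + is a signed sum of states with a single sign -, on one of
    the two circles at the changed step.  Collect the terms by the resulting
    state s(M') and by the ladder H_i of the changed step: they are indexed by
    the red steps of M'_i, with alternating signs, and two consecutive red
    steps share the intermediate circle between them.  The sum telescopes
    ([ladder_telescope]) to X_0 + (-1)^mu_i X_1, where X_0 and X_1 belong to the
    circles at the two ends of H_i.  For periphery number one both are C_i^0,
    and what remains is 2 C_i^0 or 0 according to the parity of mu_i; a ladder
    without blue steps contributes nothing.  Hence d W = 2 V
    ([diff_all_plus_sum]), where W is the sum of the all-plus states s(M) with
    sizes mu.  The same telescoping writes d V as a sum over ordered pairs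
    (i, l) of terms 2 X_i X_l, antisymmetric in i and l, so d V = 0 ([diff_V]).
    Therefore [V] is a class with 2 [V] = 0.

    To see that V is not a boundary ([V_not_boundary]), fix one state s(M)
    occurring in V, and count modulo 2 the enhanced states over s(M) with
    exactly one sign -.  All the red crossings of s(M) are bichords: the steps
    because each ladder has at least two red ones, so that an intermediate
    circle lies on one side ([red_step_split]); the red scars of s_0 because
    they are bichords in s_1, and the circles seen from outside the ladders are
    the same in s_1 and in s(M) ([exterior_circles]).  So every enhanced state
    mapping to s(M) splits a circle, and if it maps to a state with a single -
    it maps to exactly two of them, by + |-> (+,-), (-,+).  The count is thus
    even on boundaries ([minus1_count_diff]), whereas it is 1 or -1 on V.

    The facts about curves behind all this come down to one: changing the label
    of a bichord merges its two circles and leaves the other ones alone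
    ([circles_merge]). *)

(** * Half-edges, arcs and circles *)

(** A set of darts closed under the edges, or under the arcs of a smoothing, is
    even; [merge_arc] plays one parity against the other. *)
Lemma even_card_involution (T : finType) (f : T -> T) (A : {set T}) :
  involutive f -> (forall x, f x != x) -> {in A, forall x, f x \in A} ->
  ~~ odd #|A|.
Proof.
move=> fK f_neq; have [n] := ubnP #|A|.
elim: n A => // n IHn A leAn fA; have [->|[x xA]] := set_0Vmem A.
  by rewrite cards0.
have fxA : f x \in A :\ x by rewrite !inE f_neq fA.
rewrite (cardsD1 x) xA (cardsD1 (f x)) fxA /= negbK; apply: IHn.
  by move: leAn; rewrite (cardsD1 x A) xA (cardsD1 (f x) (A :\ x)) fxA; lia.
move=> y; rewrite !inE => /and3P[yfx yx yA].
rewrite fA // andbT (inj_eq (can_inj fK)) yx /=.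
by apply: contraNneq yfx => <-; rewrite fK.
Qed.

Lemma Z4_ind (P : 'Z_4 -> Prop) : P 0 -> P 1 -> P 2 -> P 3 -> forall z, P z.
Proof.
move=> P0 P1 P2 P3 [[|[|[|[|z]]]] zlt] //.
- by rewrite (_ : Ordinal zlt = 0) //; apply: val_inj.
- by rewrite (_ : Ordinal zlt = 1) //; apply: val_inj.
- by rewrite (_ : Ordinal zlt = 2) //; apply: val_inj.
- by rewrite (_ : Ordinal zlt = 3) //; apply: val_inj.
Qed.

Definition next_corner (X : finType) (c : half_edge X) : half_edge X :=
  (c.1, c.2 + 1).

Lemma oppositeK (X : finType) : involutive (@opposite X).
Proof.
by move=> [x z]; congr (x, _); elim/Z4_ind: z; apply: val_inj.
Qed.

Section Curves.
Variable D : diagram.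
Local Notation X := (crossing D).
Local Notation darts := (dart (crossing D) (free_circle D)).
Local Notation inx c := (inl c : darts).
Local Notation edgeD := (edge (L := free_circle D) (@join D)).
Implicit Types (s t : kstate D) (c d : half_edge X) (a b u v : darts).

Lemma smoothK s : involutive (smooth s).
Proof.
move=> [[x z]|[l b]] /=; last by rewrite negbK.
by congr (inl (x, _)); elim/Z4_ind: z; case: (s x); apply: val_inj.
Qed.

Lemma smooth_neq s a : smooth s a != a.
Proof.
case: a => [[x z]|[l b]] /=; last by apply/eqP => -[]; case: b.
by apply/eqP => -[]; elim/Z4_ind: z; case: (s x).
Qed.

Lemma edgeK : involutive edgeD.
Proof. by move=> [c|[l b]] /=; rewrite ?joinK ?negbK. Qed.

Lemma edge_neq a : edgeD a != a.
Proof.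
case: a => [c|[l b]] /=; last by apply/eqP => -[]; case: b.
by apply/eqP => -[e]; have := join_outgoing c; rewrite e; case: outgoing.
Qed.

Lemma smooth_eq s t c : s c.1 = t c.1 -> smooth s (inx c) = smooth t (inx c).
Proof. by move=> /= ->. Qed.

Lemma smooth_flip s t c :
  s c.1 = ~~ t c.1 -> smooth s (inx c) = smooth t (inx (opposite c)).
Proof.
case: c => x z /= ->; congr (inl (x, _)).
by elim/Z4_ind: z; case: (t x); apply: val_inj.
Qed.

Lemma smooth_opposite s c d :
  smooth s (inx c) = inl d -> smooth s (inx (opposite c)) = inl (opposite d).
Proof.
case: c => x z /= [<-]; rewrite /opposite /=; congr (inl (x, _)).
by elim/Z4_ind: z; case: (s x); apply: val_inj.
Qed.

Lemma half_edges_at s c d : d.1 = c.1 ->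
  inx d \in [:: inl c; smooth s (inl c); inl (opposite c);
                smooth s (inl (opposite c))].
Proof.
case: c d => x z [y w] /= ->.
have H (i j : 'Z_4) : (inl (x, i) == inl (x, j) :> darts) = (i == j).
  by apply/eqP/eqP => [[]|->].
rewrite !inE !H.
by elim/Z4_ind: z; elim/Z4_ind: w; case: (s x).
Qed.

Let curve s : rel darts := [rel u v | (v == edgeD u) || (v == smooth s u)].

Lemma circle_sym s : connect_sym (curve s).
Proof.
apply: sym_connect_sym => u v; rewrite /curve /=.
by congr orb; apply/eqP/eqP => ->; rewrite ?edgeK ?smoothK.
Qed.

Lemma circle_refl s a : a \in circle s a.
Proof. by rewrite inE connect0. Qed.

Lemma circle_eqP s a b : reflect (circle s a = circle s b) (b \in circle s a).
Proof.
apply: (iffP idP) => [|->]; last exact: circle_refl.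
rewrite inE => ab; apply/setP => u; rewrite !inE.
exact: (same_connect (@circle_sym s) ab).
Qed.

Lemma circle_edge s a : circle s (edgeD a) = circle s a.
Proof. by apply/esym/circle_eqP; rewrite inE connect1 //= eqxx. Qed.

Lemma circle_smooth s a : circle s (smooth s a) = circle s a.
Proof. by apply/esym/circle_eqP; rewrite inE connect1 //= eqxx orbT. Qed.

Lemma circle_sub s (E : {set darts}) a :
  {in E, forall u, edgeD u \in E} -> {in E, forall u, smooth s u \in E} ->
  a \in E -> circle s a \subset E.
Proof.
move=> Ee Es aE; apply/subsetP => b; rewrite inE => /connectP[p + ->].
elim: p a aE => [|u p IHp] a aE //= /andP[/orP[]/eqP-> path_p].
  by apply: IHp path_p; apply: Ee.
by apply: IHp path_p; apply: Es.
Qed.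

Lemma circle_edge_in s a u : (edgeD u \in circle s a) = (u \in circle s a).
Proof. by apply/circle_eqP/circle_eqP; rewrite circle_edge. Qed.

Lemma circle_smooth_in s a u : (smooth s u \in circle s a) = (u \in circle s a).
Proof. by apply/circle_eqP/circle_eqP; rewrite circle_smooth. Qed.

(** With either label, [c] and [opposite c] are on different arcs, so the ends of
    a scar may be read at any half-edge of its crossing. *)
Lemma scar_ends s c :
  circle s (inl (c.1, 0)) = circle s (inx c) /\
  circle s (inl (c.1, 2)) = circle s (inl (opposite c)) \/
  circle s (inl (c.1, 0)) = circle s (inl (opposite c)) /\
  circle s (inl (c.1, 2)) = circle s (inx c).
Proof.
have -> : (c.1, 2) = opposite (c.1, 0 : 'Z_4) by rewrite /opposite add0r.
have := @half_edges_at s c (c.1, 0) erefl.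
rewrite !inE => /or4P[]/eqP h.
- by left; rewrite (inl_inj h).
- by left; rewrite -(smooth_opposite (esym h)) h !circle_smooth.
- by right; rewrite (inl_inj h) oppositeK.
- by right; rewrite -(smooth_opposite (esym h)) oppositeK h !circle_smooth.
Qed.

Lemma bichordE s c :
  bichord s c.1 = (circle s (inx c) != circle s (inx (opposite c))).
Proof.
by rewrite /bichord; case: (scar_ends s c) => -[-> ->]; rewrite // eq_sym.
Qed.

End Curves.

(** * Merging the two circles at a bichord *)

Definition redden (D : diagram) (s : kstate D) (x : crossing D) : kstate D :=
  [ffun y => (y == x) || s y].

Section Merge.
Variable D : diagram.
Local Notation X := (crossing D).
Local Notation darts := (dart (crossing D) (free_circle D)).
Local Notation inx c := (inl c : darts).
Local Notation edgeD := (edge (L := free_circle D) (@join D)).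

Lemma circle_disjoint (s : kstate D) a b u :
  circle s a != circle s b -> u \in circle s a -> u \notin circle s b.
Proof.
by move=> ab /circle_eqP ua; apply: contra ab => /circle_eqP ub; rewrite ua ub.
Qed.

(** Cut the circle of [c] in [t] at the arc of [c].  If the other end of this arc
    were not reached from [c] in [s], the part of the circle that is reached
    would be closed under the edges, and without [c] it would still be closed
    under the arcs: both sets would be even.  Being on another circle, the
    second arc at the crossing does not interfere. *)
Lemma merge_arc (s t : kstate D) (c : half_edge X) :
  (forall y, y != c.1 -> s y = t y) -> s c.1 = ~~ t c.1 ->
  circle t (inx c) != circle t (inx (opposite c)) ->
  smooth t (inl c) \in circle s (inx c).
Proof.
move=> st_eq st_x cc; apply: contraT => a2_far.
set a1 := inx c in a2_far *; set a2 := smooth t a1 in a2_far *.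
pose K := circle t a1 :&: circle s a1.
have Ka1 : a1 \in K by rewrite in_setI !circle_refl.
have even_K : ~~ odd #|K|.
  apply: (even_card_involution (@edgeK D) (@edge_neq D)) => u.
  by rewrite !in_setI !circle_edge_in.
have : ~~ odd #|K :\ a1|.
  apply: (even_card_involution (@smoothK D t) (smooth_neq t)) => u.
  rewrite !in_setD1 !in_setI => /and3P[ua1 uA uS].
  rewrite circle_smooth_in uA /= -(can_eq (smoothK t)) smoothK -/a2.
  have ua2 : u != a2 by apply: contraNneq a2_far => <-.
  rewrite ua2 /=; case: u => [d|l] in ua1 uA uS ua2 *.
    have [d_x|d_x] := eqVneq d.1 c.1; last first.
      by rewrite -(smooth_eq (st_eq _ d_x)) circle_smooth_in.
    have := half_edges_at t d_x.
    rewrite !inE -/a1 -/a2 (negPf ua1) (negPf ua2) !orFb.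
    move: (circle_disjoint cc uA) => /[swap].
    case/orP => /eqP ->; first by rewrite circle_refl.
    by rewrite circle_smooth_in circle_refl.
  by have := circle_smooth_in s a1 (inr l); rewrite uS /= => ->.
by move: even_K; rewrite (cardsD1 a1) Ka1 /= negbK => ->.
Qed.

Variables (s : kstate D) (x : X).
Hypothesis s_x : ~~ s x.
Let t := redden s x.
Hypothesis bichord_x : bichord t x.
Let A := circle t (inx (x, 0)).
Let B := circle t (inx (x, 2)).

Let st_eq y : y != x -> s y = t y.
Proof. by rewrite ffunE => /negPf ->. Qed.

Let st_x : s x = ~~ t x.
Proof. by rewrite ffunE eqxx (negPf s_x). Qed.

Let x2 : (x, 2) = opposite (x, 0 : 'Z_4) :> half_edge X.
Proof. by rewrite /opposite add0r. Qed.

Let x0 : (x, 0) = opposite (x, 2) :> half_edge X.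
Proof. by rewrite x2 oppositeK. Qed.

Let arc0 : smooth t (inx (x, 0)) \in circle s (inx (x, 0)).
Proof. by apply: merge_arc => //; rewrite -x2. Qed.

Let arc2 : smooth t (inx (x, 2)) \in circle s (inx (x, 2)).
Proof. by apply: merge_arc => //; rewrite -x0 eq_sym. Qed.

Let at_x (d : half_edge X) : d.1 = x -> 
  [\/ inx d = inl (x, 0), inx d = smooth t (inl (x, 0)),
      inx d = inl (x, 2) | inx d = smooth t (inl (x, 2))].
Proof.
move=> d_x; have := @half_edges_at _ t (x, 0) d d_x; rewrite -x2 !inE.
by case/or4P => /eqP; [constructor 1|constructor 2|constructor 3|constructor 4].
Qed.

(** By [merge_arc], each of the two arcs lost at [x] is replaced by a path. *)
Lemma circle_merge_sub a : circle t a \subset circle s a.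
Proof.
apply: circle_sub (circle_refl s a) => u; first by rewrite circle_edge_in.
move=> /circle_eqP ->; case: u => [d|l]; last first.
  by have := circle_smooth_in s (inr l) (inr l); rewrite circle_refl.
have [d_x|d_x] := eqVneq d.1 x; last first.
  by rewrite -(smooth_eq (st_eq d_x)) circle_smooth_in circle_refl.
have sym y : smooth t (inx (x, y)) \in circle s (inx (x, y)) ->
    inx (x, y) \in circle s (smooth t (inl (x, y))).
  by move=> /circle_eqP <-; apply: circle_refl.
by case: (at_x d_x) => ->; rewrite ?smoothK // sym.
Qed.

Lemma merged_circle : circle s (inx (x, 0)) = A :|: B.
Proof.
apply/eqP; rewrite eqEsubset; apply/andP; split.
  apply: circle_sub; last by rewrite in_setU circle_refl.
    by move=> u; rewrite !in_setU !circle_edge_in.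
  move=> u; rewrite !in_setU; case: u => [d|l]; last first.
    have /= -> := circle_smooth_in t (inx (x, 0)) (inr l).
    by have /= -> := circle_smooth_in t (inx (x, 2)) (inr l).
  have [d_x _|d_x] := eqVneq d.1 x; last first.
    by rewrite (smooth_eq (st_eq d_x)) !circle_smooth_in.
  rewrite (@smooth_flip _ s t) ?d_x // !circle_smooth_in.
  have := @at_x (opposite d) d_x.
  by case=> ->; rewrite ?circle_smooth_in circle_refl ?orbT.
rewrite subUset circle_merge_sub /=.
suff -> : circle s (inx (x, 0)) = circle s (inx (x, 2)) by apply: circle_merge_sub.
rewrite -(circle_smooth s (inl (x, 0))) (@smooth_flip _ s t) // -x2.
by have /circle_eqP := arc2.
Qed.

Lemma merged_circle_of a : a \in A :|: B -> circle s a = A :|: B.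
Proof. by rewrite -merged_circle => /circle_eqP. Qed.

Lemma unmerged_circle a : a \notin A :|: B -> circle s a = circle t a.
Proof.
move=> aAB; apply/eqP; rewrite eqEsubset circle_merge_sub andbT.
apply: circle_sub (circle_refl t a) => u; first by rewrite circle_edge_in.
move=> ua; have {aAB} uAB : u \notin A :|: B.
  apply: contra aAB; move/circle_eqP: ua => ua.
  rewrite !in_setU => /orP[]/circle_eqP e; apply/orP; [left|right];
  by apply/circle_eqP; rewrite e.
case: u => [d|l] in ua uAB *; last first.
  by have /= -> := circle_smooth_in t a (inr l).
have [d_x|d_x] := eqVneq d.1 x; last first.
  by rewrite (smooth_eq (st_eq d_x)) circle_smooth_in.
case/negP: uAB; rewrite in_setU.
by case: (at_x d_x) => ->; rewrite ?circle_smooth_in circle_refl ?orbT.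
Qed.

Lemma split_circles_neq : A != B. Proof. exact: bichord_x. Qed.

Lemma circles_merge : circles s = (A :|: B) |: (circles t :\ A :\ B).
Proof.
apply/setP => C; rewrite in_setU1 !in_setD1; apply/imsetP/idP => [[a _ ->]|].
  have [aAB|aAB] := boolP (a \in A :|: B).
    by rewrite merged_circle_of // eqxx.
  rewrite unmerged_circle //; apply/orP; right.
  rewrite in_setU negb_or in aAB; case/andP: aAB => aA aB.
  rewrite imset_f // andbT; apply/andP; split.
    by apply: contraNneq aB => <-; apply: circle_refl.
  by apply: contraNneq aA => <-; apply: circle_refl.
case/orP => [/eqP ->|/and3P[CB CA /imsetP[a _ Ca]]].
  by exists (inx (x, 0)); rewrite ?merged_circle.
exists a => //; rewrite Ca unmerged_circle //; rewrite in_setU negb_or.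
rewrite {}Ca in CA CB.
by apply/andP; split; [apply: contra CA|apply: contra CB] => /circle_eqP;
  rewrite -/A -/B => ->.
Qed.

Lemma merged_notin : A :|: B \notin circles t.
Proof.
apply/imsetP => -[a _ e]; have : A == B; last by rewrite (negPf split_circles_neq).
have /circle_eqP e0 : inx (x, 0) \in circle t a by rewrite -e in_setU circle_refl.
have /circle_eqP e2 : inx (x, 2) \in circle t a by rewrite -e in_setU circle_refl orbT.
by rewrite /A /B -e0 -e2.
Qed.

Lemma split0_in : A \in circles t. Proof. exact: imset_f. Qed.
Lemma split2_in : B \in circles t. Proof. exact: imset_f. Qed.

Lemma card_circles_merge : #|circles t| = #|circles s|.+1.
Proof.
rewrite circles_merge cardsU1 !in_setD1 (negPf merged_notin) !andbF /=.
by rewrite (cardsD1 A) split0_in (cardsD1 B) !in_setD1 eq_sym split_circles_neq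
  split2_in.
Qed.

Lemma split0_notin : A \notin circles s.
Proof.
rewrite circles_merge in_setU1 !in_setD1 eqxx /= andbF orbF.
by apply: contraNneq merged_notin => <-; apply: split0_in.
Qed.

Lemma split2_notin : B \notin circles s.
Proof.
rewrite circles_merge in_setU1 !in_setD1 eqxx /= orbF.
by apply: contraNneq merged_notin => <-; apply: split2_in.
Qed.

Lemma common_circles : circles s :&: circles t = circles t :\ A :\ B.
Proof.
apply/setP => C; rewrite circles_merge in_setI in_setU1 !in_setD1.
have [->|_] := eqVneq C (A :|: B); first by rewrite (negPf merged_notin) !andbF.
by rewrite /=; case: (C \in circles t); rewrite ?andbT ?andbF.
Qed.

End Merge.

(** * The differential at a splitting crossing *)

(** The set theory behind adjacency: [P] and [Q] are the sets of plus circles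
    before and after [g] splits into [a] and [b].  Equal cardinals express that
    the degree j is kept, the other equation that common circles keep their
    signs. *)
Lemma split_signsP (T : finType) (P Q : {set T}) a b g :
  a != b -> a \notin P -> b \notin P -> g \notin Q ->
  (#|Q| == #|P|) && (Q :\ a :\ b == P :\ g)
  = (Q \in if g \in P then [set a |: (P :\ g); b |: (P :\ g)] else [set P]).
Proof.
move=> ab aP bP gQ; have ba : b != a by rewrite eq_sym.
have Qb y : Q :\ a :\ b = y -> a \in Q -> b \notin Q -> Q = a |: y.
  move=> <- aQ bQ; apply/setP => z; rewrite !inE.
  have [->|_] := eqVneq z a; first by rewrite aQ.
  by have [->|_] := eqVneq z b; rewrite ?(negPf bQ).
have Qa y : Q :\ a :\ b = y -> a \notin Q -> b \in Q -> Q = b |: y.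
  move=> <- aQ bQ; apply/setP => z; rewrite !inE.
  have [->|_] := eqVneq z b; first by rewrite bQ.
  by have [->|_] := eqVneq z a; rewrite ?(negPf aQ).
have Qn y : Q :\ a :\ b = y -> a \notin Q -> b \notin Q -> Q = y.
  move=> <- aQ bQ; apply/setP => z; rewrite !inE.
  have [->|_] := eqVneq z b; first by rewrite (negPf bQ).
  by have [->|_] := eqVneq z a; rewrite ?(negPf aQ).
have cQ : #|Q| = ((a \in Q) + (b \in Q) + #|Q :\ a :\ b|)%N.
  by rewrite (cardsD1 a) (cardsD1 b (Q :\ a)) !inE ba addnA.
have cP : #|P| = ((g \in P) + #|P :\ g|)%N by rewrite (cardsD1 g).
apply/andP/idP => [[/eqP c /eqP d]|].
  move: c; rewrite cQ cP d => /addIn.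
  case: ifP => gP /=.
    rewrite !inE; have [aQ|aQ] := boolP (a \in Q); have [bQ|bQ] := boolP (b \in Q) => // _.
      by rewrite (Qb _ d) // eqxx.
    by rewrite (Qa _ d) // eqxx orbT.
  have [aQ|aQ] := boolP (a \in Q); have [bQ|bQ] := boolP (b \in Q) => // _.
  rewrite inE (Qn _ d) //; apply/eqP/setP => z; rewrite !inE.
  by have [->|//] := eqVneq z g; rewrite gP.
have [gP|gP] := ifP; last first.
  rewrite inE => /eqP ->; split=> //; apply/eqP/setP => z; rewrite !inE.
  have [->|_] := eqVneq z b; first by rewrite (negPf bP) !andbF.
  have [->|_] := eqVneq z a; first by rewrite (negPf aP) !andbF.
  by have [->|] := eqVneq z g; rewrite ?gP.
rewrite !inE => /orP[]/eqP eQ; split.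
- by rewrite eQ cardsU1 cP gP !inE (negPf aP) andbF.
- apply/eqP/setP => z; rewrite eQ !inE.
  have [->|_] := eqVneq z b; first by rewrite (negPf bP) !andbF.
  by have [->|_] := eqVneq z a; first by rewrite (negPf aP) !andbF.
- by rewrite eQ cardsU1 cP gP !inE (negPf bP) andbF.
- apply/eqP/setP => z; rewrite eQ !inE.
  have [->|_] := eqVneq z b; first by rewrite (negPf bP) !andbF.
  by have [->|_] := eqVneq z a; first by rewrite (negPf aP) !andbF.
Qed.

Section Differential.
Variable D : diagram.
Local Notation X := (crossing D).
Local Notation darts := (dart (crossing D) (free_circle D)).
Local Notation inx c := (inl c : darts).
Implicit Types (s t : kstate D) (x : X) (e f : estate D) (P Q : {set {set darts}}).

Lemma plus_sub e : plus e \subset circles (est e).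
Proof. exact: (valP e). Qed.

Definition enhance s P (sP : P \subset circles s) : estate D :=
  exist (fun e : kstate D * {set {set darts}} => e.2 \subset circles e.1) (s, P) sP.

Lemma estate_eqE e s P : (val e == (s, P)) = (est e == s) && (plus e == P).
Proof. by rewrite /est /plus; case: (val e). Qed.

Lemma thetaE e : theta e = #|plus e|%:Z + #|plus e|%:Z - #|circles (est e)|%:Z.
Proof.
rewrite /theta cardsD (setIidPr (plus_sub e)).
have := subset_leq_card (plus_sub e); lia.
Qed.

(** The rules + |-> (+,-), (-,+) and - |-> (-,-) for the circle splitting at
    [x], in terms of the set of plus circles. *)
Definition split_signs s x P : {set {set {set darts}}} :=
  let A := circle (redden s x) (inl (x, 0)) in
  let B := circle (redden s x) (inl (x, 2)) in
  if A :|: B \in P then [set A |: (P :\ (A :|: B)); B |: (P :\ (A :|: B))]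
  else [set P].

Lemma card_redden s x :
  ~~ s x -> #|[set y | redden s x y]| = #|[set y | s y]|.+1.
Proof.
move=> s_x; rewrite (_ : [set y | redden s x y] = x |: [set y | s y]).
  by rewrite cardsU1 inE s_x.
by apply/setP => y; rewrite !inE ffunE.
Qed.

Lemma adjacent_split x e f : ~~ est e x -> bichord (redden (est e) x) x ->
  adjacent_at x e f
  = (est f == redden (est e) x) && (plus f \in split_signs (est e) x (plus e)).
Proof.
move=> e_x bi; rewrite /adjacent_at e_x /= -/(redden (est e) x).
have [f_t|//] := eqVneq (est f) (redden (est e) x); rewrite /=.
rewrite /ideg f_t card_redden // /jdeg /ideg f_t card_redden // !thetaE f_t.
rewrite (card_circles_merge e_x bi).
rewrite [X in X && _](_ : _ = true) ?andTb; last by apply/eqP; lia.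
set A := circle (redden (est e) x) (inx (x, 0)).
set B := circle (redden (est e) x) (inx (x, 2)).
rewrite [X in X && _](_ : _ = (#|plus f| == #|plus e|)); last first.
  by apply/eqP/eqP; lia.
have Pe := subsetP (plus_sub e); have Pf := subsetP (plus_sub f).
rewrite f_t in Pf.
rewrite -split_signsP; first last.
- by apply: contra (merged_notin bi); apply: Pf.
- by apply: contra (split2_notin e_x bi); apply: Pe.
- by apply: contra (split0_notin e_x bi); apply: Pe.
- exact: bi.
congr andb; rewrite common_circles // -/A -/B.
have inK C : C \in plus e -> C != A :|: B -> C \in circles (redden (est e) x) :\ A :\ B.
  by move=> /Pe; rewrite (circles_merge e_x bi) in_setU1 => /orP[->|].
apply/forallP/eqP => [H|H C].
  apply/setP => C; have := H C; rewrite [LHS]in_setD1 in_setD1 [RHS]in_setD1.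
  have [CK|nCK] := boolP (C \in circles (redden (est e) x) :\ A :\ B) => /=.
    move=> /eqP <-; move: CK; rewrite !in_setD1 => /and3P[-> -> CT] /=.
    by apply/esym/andb_idl => _; apply: contraTneq CT => ->; rewrite (merged_notin bi).
  move=> _; apply/idP/idP => [/and3P[CB CA /Pf CT]|/andP[Cg Cp]].
    by rewrite !in_setD1 CB CA CT in nCK.
  by rewrite (inK C Cp Cg) in nCK.
apply/implyP => CK; have := CK; rewrite !in_setD1 => /and3P[CB CA CT].
have := congr1 (fun Z : {set _} => C \in Z) H; rewrite !in_setD1 CB CA /= => ->.
by apply/eqP/esym/andb_idl => _; apply: contraTneq CT => ->; rewrite (merged_notin bi).
Qed.

End Differential.

Section Chains.
Variable D : diagram.
Local Notation X := (crossing D).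
Local Notation darts := (dart (crossing D) (free_circle D)).
Local Notation inx c := (inl c : darts).
Implicit Types (s t : kstate D) (x : X) (e f : estate D) (P Q : {set {set darts}}).

HB.instance Definition _ num :=
  GRing.isZmodMorphism.Build (chain D) (chain D) (@diff D num) (@diffB D num).

Lemma chain_sumE (I : Type) (r : seq I) (p : pred I) (F : I -> chain D) e :
  (\sum_(i <- r | p i) F i) e = \sum_(i <- r | p i) F i e.
Proof. exact: sum_ffunE. Qed.

Lemma chain_mulzE (c : chain D) (n : int) e : (c *~ n) e = c e *~ n.
Proof. by case: n => n; rewrite /intmul ?ffunE ffunMnE. Qed.

Definition all_split s : Prop := forall x, ~~ s x -> bichord (redden s x) x.

Lemma diff_generator num s P : P \subset circles s -> all_split s ->
  diff num (generator s P)
  = \sum_(x | ~~ s x) \sum_(Q in split_signs s x P)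
      generator (redden s x) Q *~ (-1) ^+ nb_before num x s.
Proof.
move=> sP bi; apply/ffunP => f; rewrite chain_sumE ffunE [RHS]big_mkcond /=.
apply: eq_bigr => x _.
pose e := enhance sP.
transitivity ((adjacent_at x e f)%:R *~ (-1) ^+ nb_before num x s : int).
  rewrite big_mkcond (bigD1 e) //= big1 ?addr0 => [|e' ne].
    case: ifP => _; last by rewrite mul0rz.
    by rewrite /est ffunE /= eqxx mulr1 intz.
  rewrite ffunE (negPf (_ : val e' != (s, P))) ?mulr0 ?if_same //.
have [s_x|s_x] := boolP (s x); first by rewrite /adjacent_at [est e x]s_x mul0rz.
rewrite (@adjacent_split D x e f) //= ?bi // chain_sumE -[est e]/s -[plus e]/P.
have [fQ|fQ] := boolP (plus f \in split_signs s x P); last first.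
  rewrite andbF mul0rz big1 // => Q; rewrite chain_mulzE ffunE estate_eqE.
  by have [<-|_ _] := eqVneq (plus f) Q; rewrite ?(negPf fQ) // andbF mul0rz.
rewrite (bigD1 (plus f)) //= big1 ?addr0 => [|Q /andP[_ nQ]].
  by rewrite chain_mulzE ffunE estate_eqE eqxx.
by rewrite chain_mulzE ffunE estate_eqE eq_sym [plus f == _]eq_sym (negPf nQ) andbF mul0rz.
Qed.

Definition minus1 t C : chain D := generator t (circles t :\ C).

(** The product X_C X_C', which vanishes when the two circles coincide. *)
Definition minus2 t C C' : chain D :=
  if C == C' then 0 else generator t (circles t :\ C :\ C').

Lemma minus2C t C C' : minus2 t C C' = minus2 t C' C.
Proof. by rewrite /minus2 eq_sym setDDl setUC -setDDl. Qed.

Lemma minus2_id t C : minus2 t C C = 0.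
Proof. by rewrite /minus2 eqxx. Qed.

Lemma diff_all_plus num s : all_split s ->
  diff num (generator s (circles s))
  = \sum_(x | ~~ s x)
      (minus1 (redden s x) (circle (redden s x) (inl (x, 0)))
       + minus1 (redden s x) (circle (redden s x) (inl (x, 2))))
      *~ (-1) ^+ nb_before num x s.
Proof.
move=> bi; rewrite diff_generator //; apply: eq_bigr => x s_x.
have b_x := bi x s_x; rewrite /split_signs.
set A := circle _ _; set B := circle _ _.
have AB : A != B := b_x.
have e : circles s :\ (A :|: B) = circles (redden s x) :\ A :\ B.
  rewrite (circles_merge s_x b_x) setU1K // !in_setD1.
  by rewrite (negPf (merged_notin b_x)) !andbF.
have eA : A |: (circles (redden s x) :\ A :\ B) = circles (redden s x) :\ B.
  by rewrite setDDl [[set A] :|: [set B] in LHS]setUC -setDDl setD1K // in_setD1 AB split0_in.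
have eB : B |: (circles (redden s x) :\ A :\ B) = circles (redden s x) :\ A.
  by rewrite setD1K // in_setD1 eq_sym AB split2_in.
rewrite {1}(circles_merge s_x b_x) setU11 e eA eB big_setU1 /= ?big_set1.
  by rewrite addrC -mulrzDl /minus1.
rewrite inE; apply: contraNneq (AB) => h.
have : A \in circles (redden s x) :\ B by rewrite in_setD1 AB split0_in.
by rewrite h in_setD1 eqxx.
Qed.

(** If the circle of [a] splits at [x], both parts get the sign -.  The circle of
    [a] is then one of the two parts and one of the two [minus2] vanishes, so
    that the formula does not depend on whether this circle splits. *)
Lemma diff_minus1 num s a : all_split s ->
  diff num (minus1 s (circle s a))
  = \sum_(x | ~~ s x)
      (minus2 (redden s x) (circle (redden s x) a)
              (circle (redden s x) (inl (x, 0)))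
       + minus2 (redden s x) (circle (redden s x) a)
              (circle (redden s x) (inl (x, 2))))
      *~ (-1) ^+ nb_before num x s.
Proof.
move=> bi; rewrite diff_generator ?subD1set //; apply: eq_bigr => x s_x.
have b_x := bi x s_x; rewrite /split_signs.
set t := redden s x; set A := circle t (inl (x, 0)).
set B := circle t (inl (x, 2)).
have AB : A != B := b_x.
have e : circles s :\ (A :|: B) = circles t :\ A :\ B.
  rewrite (circles_merge s_x b_x) setU1K // !in_setD1.
  by rewrite (negPf (merged_notin b_x)) !andbF.
have [a_AB|a_AB] := boolP (a \in A :|: B).
  rewrite (merged_circle_of s_x b_x a_AB) in_setD1 eqxx /= big_set1 e.
  congr (_ *~ _); move: a_AB; rewrite in_setU => /orP[]/circle_eqP => <-.
    by rewrite minus2_id add0r /minus2 (negPf AB).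
  by rewrite minus2_id addr0 minus2C /minus2 (negPf AB).
rewrite (unmerged_circle s_x b_x a_AB) -/t.
have aA : A != circle t a.
  by apply: contraNneq a_AB => h; rewrite in_setU h circle_refl.
have aB : B != circle t a.
  by apply: contraNneq a_AB => h; rewrite in_setU h circle_refl orbT.
have aAB : A :|: B != circle t a.
  by apply: contraNneq (merged_notin b_x) => ->; apply: imset_f.
have AB_s : A :|: B \in circles s by rewrite (circles_merge s_x b_x) setU11.
have -> : circles s :\ circle t a :\ (A :|: B) = circles t :\ A :\ B :\ circle t a.
  by rewrite -e setDDl [[set circle t a] :|: _]setUC -setDDl.
rewrite in_setD1 aAB AB_s /=.
have eA : A |: (circles t :\ A :\ B :\ circle t a) = circles t :\ circle t a :\ B.
  apply/setP => C; rewrite !(in_setU1, in_setD1).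
  have [->|_] := eqVneq C A; first by rewrite aA AB split0_in.
  by rewrite orFb andTb andbCA.
have eB : B |: (circles t :\ A :\ B :\ circle t a) = circles t :\ circle t a :\ A.
  apply/setP => C; rewrite !(in_setU1, in_setD1).
  have [->|_] := eqVneq C B; first by rewrite aB eq_sym AB split2_in.
  by rewrite orFb andTb andbCA.
rewrite eA eB big_setU1 /= ?big_set1.
  by rewrite addrC -mulrzDl /minus2 ![circle t a == _]eq_sym (negPf aA) (negPf aB).
rewrite inE; apply: contraNneq (AB) => h.
have : A \in circles t :\ circle t a :\ B by rewrite !in_setD1 AB aA split0_in.
by rewrite h in_setD1 eqxx.
Qed.

(** In [e] the two circles of [t] at [x] are merged.  If the merged circle has
    the sign +, [e] is adjacent to two states over [t], which have equally many
    minus circles; if it has the sign -, the state over [t] adjacent to [e] has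
    at least two of them. *)
Lemma even_adjacent t x e : ~~ est e x -> t = redden (est e) x -> bichord t x ->
  ~~ odd #|[set f : estate D |
     [&& est f == t, #|plus f|.+1 == #|circles t| & adjacent_at x e f]]|.
Proof.
move=> e_x -> {t} bi; set t := redden _ _.
set S := [set f | _].
have SE : S = [set f : estate D | [&& est f == t, #|plus f|.+1 == #|circles t|
     & plus f \in split_signs (est e) x (plus e)]].
  apply/setP => f; rewrite !in_set adjacent_split // -/t.
  by case: (est f == t).
have : {in S &, injective (@plus D)}.
  move=> f f'; rewrite !in_set => /andP[/eqP fS _] /andP[/eqP fS' _] ff'.
  by apply: val_inj; apply/eqP; rewrite [val f']surjective_pairing estate_eqE
    -/(est f') -/(plus f') fS fS' ff' !eqxx.
move/card_in_imset => <-.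
have -> : [set plus f | f in S]
  = [set Q in split_signs (est e) x (plus e)
      | (Q \subset circles t) && (#|Q|.+1 == #|circles t|)].
  apply/setP => Q; rewrite inE; apply/imsetP/idP => [[f + ->]|].
    rewrite SE inE => /and3P[/eqP <- -> ->]; by rewrite plus_sub.
  case/and3P => Q_e Q_t Q_c; exists (enhance Q_t) => //.
  by rewrite SE inE -[est _]/t -[plus _]/Q eqxx Q_e Q_c.
have := plus_sub e; move: (plus e) => P sP {S SE}.
have c_t := card_circles_merge e_x bi; rewrite -/t in c_t.
rewrite /split_signs -/t.
set A := circle t (inl (x, 0)); set B := circle t (inl (x, 2)).
case: ifP => P_AB; last first.
  rewrite (_ : [set Q in _ | _] = set0) ?cards0 //.
  apply/setP => Q; rewrite !inE; apply: contraFF P_AB => /and3P[/eqP -> _].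
  rewrite c_t eqSS => /eqP c_P.
  suff -> : P = circles (est e) by rewrite (circles_merge e_x bi) setU11.
  by apply/eqP; rewrite eqEcard sP c_P leqnn.
have AB : A != B := bi.
set P' := P :\ (A :|: B).
have P'_t : P' \subset circles t.
  apply/subsetP => C; rewrite in_setD1 => /andP[C_AB /(subsetP sP)].
  by rewrite (circles_merge e_x bi) in_setU1 (negPf C_AB) !in_setD1 => /and3P[].
have A_P' : A \notin P'.
  rewrite in_setD1; apply: contra (split0_notin e_x bi) => /andP[_].
  exact: (subsetP sP).
have B_P' : B \notin P'.
  rewrite in_setD1; apply: contra (split2_notin e_x bi) => /andP[_].
  exact: (subsetP sP).
have AP_BP : A |: P' != B |: P'.
  apply: contraNneq (AB) => h; have : A \in A |: P' by rewrite setU11.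
  by rewrite h in_setU1 (negPf A_P') orbF.
have [c_P'|c_P'] := eqVneq #|P'|.+2 #|circles t|.
  rewrite (_ : [set Q in _ | _] = [set A |: P'; B |: P']) ?cards2 ?AP_BP //.
  apply/setP => Q; rewrite inE; apply: andb_idr; rewrite in_set2.
  by case/orP => /eqP ->; rewrite subUset sub1set P'_t cardsU1 ?A_P' ?B_P'
    ?split0_in ?split2_in /= add1n c_P'.
rewrite (_ : [set Q in _ | _] = set0) ?cards0 //.
apply/setP => Q; rewrite !inE; apply: contraNF c_P' => /and3P[].
by case/orP => /eqP ->; rewrite cardsU1 ?A_P' ?B_P'.
Qed.

(** * Counting states with one minus sign *)

Definition minus1_count (t : kstate D) (c : chain D) : int :=
  \sum_(f : estate D | (est f == t) && (#|plus f|.+1 == #|circles t|)) c f.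

Lemma minus1_count_is_zmod_morphism t : zmod_morphism (minus1_count t).
Proof.
by move=> c c'; rewrite -sumrB; apply: eq_bigr => f _; rewrite !ffunE.
Qed.

HB.instance Definition _ t :=
  GRing.isZmodMorphism.Build (chain D) int (minus1_count t)
    (@minus1_count_is_zmod_morphism t).

Lemma minus1_count_generator t s C : C \in circles s ->
  minus1_count t (minus1 s C) = (s == t)%:R.
Proof.
move=> C_s; rewrite /minus1_count.
pose e := enhance (subD1set (circles s) C).
have gen f : minus1 s C f = (f == e)%:R.
  by rewrite ffunE; congr (nat_of_bool _)%:R; apply/eqP/eqP => [h|->//]; apply: val_inj.
under eq_bigr do rewrite gen.
have [<-|st] := eqVneq s t.
  rewrite (bigD1 e) /=; last by rewrite eqxx /= (cardsD1 C (circles s)) C_s.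
  by rewrite eqxx big1 ?addr0 // => f /andP[_ /negPf ->].
rewrite big1 // => f /andP[/eqP f_t _].
by case: eqP => // fe; case/eqP: st; rewrite -f_t fe.
Qed.

(** Each enhanced state contributes its coefficient as many times as it is
    adjacent to a state that is counted: an even number, by [even_adjacent]. *)
Lemma minus1_count_diff num t (c : chain D) : (forall x, t x -> bichord t x) ->
  (2 %| minus1_count t (diff num c))%Z.
Proof.
move=> bi; rewrite /minus1_count.
under eq_bigr do rewrite ffunE.
rewrite exchange_big; apply: rpred_sum => x _ /=.
rewrite (exchange_big_dep xpredT) //=; apply: rpred_sum => e _.
set a := _ * c e; rewrite sumr_const.
suff : ~~ odd #|[set f : estate D |
    [&& est f == t, #|plus f|.+1 == #|circles t| & adjacent_at x e f]]|.
  rewrite -dvdn2 => /dvdnP[n n_eq].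
  rewrite (_ : #|_| = n * 2)%N; last first.
    by rewrite -n_eq; apply: eq_card => f; rewrite !inE andbA.
  by apply/dvdzP; exists (a *+ n); rewrite mulrnA -[LHS]mulr_natr.
have [|none] := boolP [exists f : estate D, (est f == t) && adjacent_at x e f].
  case/existsP => f /andP[/eqP f_t f_e].
  have /and5P[e_x /eqP fE _ _ _] := f_e.
  apply: even_adjacent => //; first by rewrite -f_t fE.
  by apply: bi; rewrite -f_t fE ffunE eqxx.
rewrite (_ : [set f | _] = set0) ?cards0 //; apply/setP => f; rewrite !inE.
by apply: contraNF none => /and3P[f_t _ f_e]; apply/existsP; exists f; rewrite f_t.
Qed.

Lemma hclass_eq0 (num : seq X) (i j : int) (z : cycles num i j) :
  (hclass z == 0) = (z \in boundaries num i j).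
Proof.
rewrite -[in RHS](subr0 z) Quotient.idealrBE; congr (_ == _); symmetry.
exact: (raddf0 (\pi_(Quotient.quot (boundaries num i j)))%qT).
Qed.

Lemma hclassMn (num : seq X) (i j : int) (z : cycles num i j) n :
  hclass (z *+ n) = hclass z *+ n.
Proof. exact: raddfMn. Qed.

End Chains.

(** * Ladders and the numbering of their crossings *)

Lemma half_edges_neq (X : finType) (c : half_edge X) :
  [/\ c != next_corner c, c != opposite c & c != next_corner (opposite c)].
Proof.
by case: c => x z; rewrite !xpair_eqE eqxx; elim/Z4_ind: z.
Qed.

Lemma odd_opposite (X : finType) (c : half_edge X) :
  odd (opposite c).2 = odd c.2.
Proof. by case: c => x z; elim/Z4_ind: z. Qed.

Section Ladders.
Variables (D : diagram) (s0 : kstate D) (k : nat).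
Variable H : 'I_k -> seq (half_edge (crossing D)).
Hypothesis H_grouped : grouped s0 H.
Variable cut : forall i : 'I_k, 'I_(size (H i)).
Local Notation X := (crossing D).
Local Notation darts := (dart (crossing D) (free_circle D)).
Local Notation inx c := (inl c : darts).
Local Notation edgeD := (edge (L := free_circle D) (@join D)).
Implicit Types (s t : kstate D) (x : X) (i l : 'I_k) (n p q : nat).

Definition rung i n : half_edge X := nth (step (cut i)) (H i) n.

Lemma step_rung i (m : 'I_(size (H i))) : step m = rung i m.
Proof. exact: tnth_nth. Qed.

Lemma ladder_disc_of i : ladder_disc s0 (H i).
Proof. by case: H_grouped => /(_ i)[]. Qed.

Lemma rung_odd i n : (n < size (H i))%N -> odd (rung i n).2.
Proof.
move=> n_lt; have /and4P[_ /allP + _ _] := ladder_disc_of i.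
by move=> /(_ _ (mem_nth (step (cut i)) n_lt)) /andP[].
Qed.

Lemma rung_blue i n : (n < size (H i))%N -> ~~ s0 (rung i n).1.
Proof.
move=> n_lt; have /and4P[_ /allP + _ _] := ladder_disc_of i.
by move=> /(_ _ (mem_nth (step (cut i)) n_lt)) /andP[].
Qed.

(** The bigon between two consecutive rungs has one side on each rail of the
    ladder: [join_rung] and [join_opposite_rung] are these two sides. *)
Lemma join_rung i n : (n.+1 < size (H i))%N ->
  join (rung i n) = next_corner (opposite (rung i n.+1)).
Proof.
move=> n_lt; have /and4P[_ _ _ /(sortedP (step (cut i)))] := ladder_disc_of i.
move=> /(_ n n_lt) /and4P[/eqP+ _ _ _]; rewrite /boundary /=.
rewrite -/(rung i n) -/(rung i n.+1) => e.
have e1 : (join (rung i n)).1 = (rung i n.+1).1.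
  exact: (congr1 fst (inl_inj e)).
have e2 : (join (rung i n)).2 - 1 = (rung i n.+1).2 + 2.
  exact: (congr1 snd (inl_inj e)).
apply/eqP; rewrite [join _]surjective_pairing xpair_eqE e1 eqxx /=.
by rewrite -e2 subrK.
Qed.

Lemma join_opposite_rung i n : (n.+1 < size (H i))%N ->
  join (opposite (rung i n.+1)) = next_corner (rung i n).
Proof.
move=> n_lt; have /and4P[_ _ _ /(sortedP (step (cut i)))] := ladder_disc_of i.
move=> /(_ n n_lt) /and4P[_ /eqP+ _ _]; rewrite /boundary /=.
rewrite -/(rung i n) -/(rung i n.+1) => e.
have e1 : (join (opposite (rung i n.+1))).1 = (rung i n).1.
  exact: (congr1 fst (inl_inj e)).
have e2 : (join (opposite (rung i n.+1))).2 - 1 = (rung i n).2.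
  exact: (congr1 snd (inl_inj e)).
apply/eqP; rewrite [join _]surjective_pairing xpair_eqE e1 eqxx /=.
by rewrite -e2 subrK.
Qed.

Let heights := [seq size (H i) | i : 'I_k].

Lemma shape_ladders : shape [seq unzip1 (H i) | i : 'I_k] = heights.
Proof.
by rewrite /shape -map_comp; apply: eq_map => i /=; rewrite size_map.
Qed.

Lemma nth_heights i : nth 0%N heights i = size (H i).
Proof.
by rewrite (nth_map i) ?size_enum_ord // nth_ord_enum.
Qed.

Lemma nth_ladder_crossings i n x : (n < size (H i))%N ->
  nth x (ladder_crossings H) (flatten_index heights i n) = (rung i n).1.
Proof.
move=> n_lt; rewrite nth_flatten shape_ladders.
rewrite flatten_indexKl ?flatten_indexKr ?nth_heights //.
rewrite (nth_map i) ?size_enum_ord // nth_ord_enum.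
by rewrite (nth_map (step (cut i))).
Qed.

Lemma ladder_crossings_uniq : uniq (ladder_crossings H).
Proof. by case: H_grouped => _ /perm_uniq ->; apply: enum_uniq. Qed.

Lemma flatten_index_lt i n : (n < size (H i))%N ->
  (flatten_index heights i n < size (ladder_crossings H))%N.
Proof.
move=> n_lt; rewrite size_flatten shape_ladders.
by apply: flatten_indexP; rewrite nth_heights.
Qed.

Lemma index_ladder_crossings i n : (n < size (H i))%N ->
  index (rung i n).1 (ladder_crossings H) = flatten_index heights i n.
Proof.
move=> n_lt; rewrite -(nth_ladder_crossings (rung i n).1 n_lt).
by rewrite index_uniq ?flatten_index_lt ?ladder_crossings_uniq.
Qed.

Lemma rung_inj i l n p : (n < size (H i))%N -> (p < size (H l))%N ->
  (rung i n).1 = (rung l p).1 -> i = l /\ n = p.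
Proof.
move=> n_lt p_lt /(congr1 (fun x => index x (ladder_crossings H))).
rewrite !index_ladder_crossings // => e; split.
  apply: val_inj; have := congr1 (reshape_index heights) e.
  by rewrite !flatten_indexKl ?nth_heights.
have := congr1 (reshape_offset heights) e.
by rewrite !flatten_indexKr ?nth_heights.
Qed.

Lemma blue_rung x : ~~ s0 x ->
  exists i (m : 'I_(size (H i))), x = (step m).1.
Proof.
move=> x_blue; have : x \in ladder_crossings H.
  by case: H_grouped => _ /perm_mem ->; rewrite mem_enum.
case/flattenP => _ /mapP[i _ ->] /mapP[c c_in ->].
have c_lt : (index c (H i) < size (H i))%N by rewrite index_mem.
exists i, (Ordinal c_lt) => //.
by rewrite step_rung /= /rung nth_index.
Qed.

Lemma flatten_index_mono i l n p :
  (n < size (H i))%N -> (p < size (H l))%N ->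
  (flatten_index heights l p < flatten_index heights i n)%N
  = (l < i)%N || (l == i) && (p < n)%N.
Proof.
have mono j j' m m' : (m < size (H j))%N -> (j < j')%N ->
    (flatten_index heights j m < flatten_index heights j' m')%N.
  move=> m_lt jj'; rewrite /flatten_index.
  have j_lt : (j < size heights)%N by rewrite size_map size_enum_ord.
  rewrite -(subnKC jj') takeD sumn_cat (take_nth 0%N) // sumn_rcons nth_heights.
  by rewrite -!addnA ltn_add2l; apply: (leq_trans m_lt); apply: leq_addr.
move=> n_lt p_lt; rewrite -[l == i]/(l == i :> nat).
have [li|il|li] := ltngtP l i; first by rewrite mono.
  by apply/negbTE; rewrite -leqNgt ltnW // mono.
by rewrite (ord_inj li) /flatten_index ltn_add2l.
Qed.

Lemma big_blue (R : Type) (idx : R) (op : Monoid.com_law idx) (F : X -> R) :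
  \big[op/idx]_(x | ~~ s0 x) F x
  = \big[op/idx]_(i < k) \big[op/idx]_(m < size (H i)) F (step m).1.
Proof.
case: H_grouped => _ pe.
rewrite -big_enum -(perm_big _ pe) big_flatten big_image /=.
apply: eq_bigr => i _; rewrite big_map (big_nth (step (cut i))) big_mkord.
by apply: eq_bigr => m _; rewrite (step_rung m).
Qed.

(** * Gaps between the rungs of a ladder *)

Lemma smooth_red t (c : half_edge X) : odd c.2 -> t c.1 ->
  smooth t (inx c) = inl (next_corner c).
Proof. by move=> /= -> ->. Qed.

Lemma smooth_blue t (c : half_edge X) : odd c.2 -> ~~ t c.1 ->
  smooth t (inx c) = inl (next_corner (opposite c)).
Proof.
case: c => x z /= z_odd /negPf ->; rewrite z_odd; congr (inl (x, _)) => /=.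
by move: z_odd; elim/Z4_ind: z => // _; apply: val_inj.
Qed.

(** The gap n of a ladder lies between its rungs n - 1 and n; the gaps 0 and
    [size (H i)] are beyond its two ends.  The corner named by the rung n and
    its two half-edges are in the gap n + 1, the opposite ones in the gap n. *)
Definition rung_in i n p q (c : half_edge X) : bool :=
  ((c == rung i n) || (c == next_corner (rung i n))) && (p <= n.+1 <= q)%N
  || ((c == opposite (rung i n)) || (c == next_corner (opposite (rung i n))))
     && (p <= n <= q)%N.

Definition between i p q : {set darts} :=
  [set a | if a is inl c then
             [exists m : 'I_(size (H i)), rung_in i m p q c] else false].

Lemma rung_in_crossing i n p q c : rung_in i n p q c -> c.1 = (rung i n).1.
Proof. by case/orP => /andP[/orP[]/eqP ->]. Qed.

Lemma betweenP i p q n (c : half_edge X) : (n < size (H i))%N ->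
  c.1 = (rung i n).1 -> (inx c \in between i p q) = rung_in i n p q c.
Proof.
move=> n_lt c_n; rewrite inE; apply/existsP/idP => [[m c_m]|c_in]; last first.
  by exists (Ordinal n_lt).
have e : (rung i n).1 = (rung i m).1 by rewrite -c_n (rung_in_crossing c_m).
by have [_ ->] := rung_inj n_lt (ltn_ord m) e.
Qed.

Lemma rung_between i p q n : (n < size (H i))%N ->
  (inx (rung i n) \in between i p q) = (p <= n.+1 <= q)%N.
Proof.
move=> n_lt; rewrite (betweenP _ _ n_lt) // /rung_in eqxx /=.
by have [_ /negPf -> /negPf ->] := half_edges_neq (rung i n); rewrite /= orbF.
Qed.

Lemma opposite_rung_between i p q n : (n < size (H i))%N ->
  (inx (opposite (rung i n)) \in between i p q) = (p <= n <= q)%N.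
Proof.
move=> n_lt; rewrite (betweenP _ _ n_lt) // /rung_in eqxx /=.
have [_ + +] := half_edges_neq (opposite (rung i n)).
by rewrite oppositeK => /negPf -> /negPf ->.
Qed.

Lemma other_ladder_between i l p q n (c : half_edge X) : l != i ->
  (n < size (H l))%N -> c.1 = (rung l n).1 -> inx c \notin between i p q.
Proof.
move=> li n_lt c_n; rewrite inE; apply/existsP => -[m /rung_in_crossing c_m].
have [e _] := rung_inj n_lt (ltn_ord m) (etrans (esym c_n) c_m).
by rewrite e eqxx in li.
Qed.

Lemma red_between i p q (c : half_edge X) : s0 c.1 -> inx c \notin between i p q.
Proof.
move=> c_red; rewrite inE; apply/existsP => -[m /rung_in_crossing c_m].
by have := rung_blue (ltn_ord m); rewrite -c_m c_red.
Qed.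

Lemma between_sub i p q p' q' :
  (p' <= p)%N -> (q <= q')%N -> between i p q \subset between i p' q'.
Proof.
move=> pp qq; apply/subsetP => a; rewrite !in_set; case: a => // c /existsP[m c_m].
apply/existsP; exists m; case/orP: c_m => /andP[e /andP[p_le le_q]].
  by apply/orP; left; rewrite e (leq_trans pp p_le) (leq_trans le_q qq).
by apply/orP; right; rewrite e (leq_trans pp p_le) (leq_trans le_q qq).
Qed.

(** Edges starting in a gap other than the two extreme ones are sides of the
    bigon that fills it. *)
Lemma between_edge i p q : (0 < p)%N -> (q < size (H i))%N ->
  {in between i p q, forall a, edgeD a \in between i p q}.
Proof.
move=> p_gt q_lt a; rewrite {1}in_set; case: a => // c /existsP[[n n_lt] /=].
case/orP => /andP[/orP[]/eqP -> /andP[p_le le_q]]; rewrite /edge.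
- have n1_lt : (n.+1 < size (H i))%N by apply: leq_ltn_trans q_lt.
  rewrite (join_rung n1_lt) (betweenP _ _ n1_lt) //.
  by rewrite /rung_in eqxx !orbT p_le le_q orbT.
- have n1_lt : (n.+1 < size (H i))%N by apply: leq_ltn_trans q_lt.
  by rewrite -(join_opposite_rung n1_lt) joinK opposite_rung_between ?p_le.
- case: n => [|n] in n_lt p_le le_q *; first by case: p p_gt p_le.
  rewrite (join_opposite_rung n_lt) (@betweenP _ _ _ n) ?(ltnW n_lt) //.
  by rewrite /rung_in eqxx orbT p_le le_q.
- case: n => [|n] in n_lt p_le le_q *; first by case: p p_gt p_le.
  by rewrite -(join_rung n_lt) joinK rung_between ?(ltnW n_lt) ?p_le.
Qed.

(** The arcs at a blue rung join the gaps on its two sides, those at a red rung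
    stay in one gap; so red rungs bounding the region keep the curves inside. *)
Lemma between_smooth t i p q : (p <= q < size (H i))%N -> (0 < p)%N ->
  t (rung i p.-1).1 -> t (rung i q).1 ->
  {in between i p q, forall a, smooth t a \in between i p q}.
Proof.
move=> /andP[pq q_lt] p_gt t_p t_q a; rewrite {1}in_set.
case: a => // c /existsP[[n n_lt] c_in]; have {c_in} : rung_in i n p q c := c_in.
have n_odd := rung_odd n_lt.
have on_odd : odd (opposite (rung i n)).2 by rewrite odd_opposite.
have [n_red|n_blue] := boolP (t (rung i n).1).
  have r1 := smooth_red n_odd n_red; have r2 := smooth_red on_odd n_red.
  case/orP => /andP[/orP[]/eqP -> /andP[p_le le_q]].
  - rewrite r1 (betweenP _ _ n_lt) //.
    by rewrite /rung_in eqxx orbT p_le le_q.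
  - by rewrite -r1 smoothK rung_between // p_le le_q.
  - rewrite r2 (betweenP _ _ n_lt) //.
    by rewrite /rung_in eqxx orbT p_le le_q !orbT.
  - by rewrite -r2 smoothK opposite_rung_between // p_le le_q.
have np : n.+1 != p by apply: contraNneq n_blue => e; rewrite -e in t_p.
have nq : n != q by apply: contraNneq n_blue => ->.
have b1 := smooth_blue n_odd n_blue; have b2 := smooth_blue on_odd n_blue.
rewrite oppositeK in b2.
case/orP => /andP[/orP[]/eqP -> /andP[p_le le_q]].
- rewrite b1 (betweenP _ _ n_lt) // /rung_in eqxx orbT.
  by rewrite (_ : p <= n <= q)%N ?orbT //; lia.
- by rewrite -b2 smoothK opposite_rung_between //; lia.
- rewrite b2 (betweenP _ _ n_lt) // /rung_in eqxx orbT.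
  by rewrite (_ : p <= n.+1 <= q)%N //; lia.
- by rewrite -b1 smoothK rung_between //; lia.
Qed.

Definition interior i : {set darts} := between i 1 (size (H i)).-1.

(** Curves that enter the gaps between two red rungs never leave them. *)
Lemma red_pair_split t i n n' : (n < n' < size (H i))%N ->
  t (rung i n).1 -> t (rung i n').1 ->
  [/\ circle t (inl (rung i n)) \subset interior i,
      circle t (inl (rung i n)) != circle t (inl (opposite (rung i n))),
      circle t (inl (opposite (rung i n'))) \subset interior i
    & circle t (inl (rung i n')) != circle t (inl (opposite (rung i n')))].
Proof.
move=> /andP[nn' n'_lt] t_n t_n'; have n_lt := ltn_trans nn' n'_lt.
pose E := between i n.+1 n'.
have E_sub a : a \in E -> circle t a \subset E.
  apply: circle_sub; first exact: between_edge.
  by apply: between_smooth; rewrite ?nn'.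
have E_int : E \subset interior i by apply: between_sub => //; lia.
have r_n : inx (rung i n) \in E by rewrite rung_between // leqnn.
have o_n' : inx (opposite (rung i n')) \in E.
  by rewrite opposite_rung_between // leqnn andbT.
split.
- exact: subset_trans (E_sub _ r_n) E_int.
- apply/eqP => e; have := subsetP (E_sub _ r_n) (inl (opposite (rung i n))).
  by rewrite e circle_refl opposite_rung_between // ltnn => /(_ isT).
- exact: subset_trans (E_sub _ o_n') E_int.
- apply/eqP => e; have := subsetP (E_sub _ o_n') (inl (rung i n')).
  by rewrite -e circle_refl rung_between // ltnn andbF => /(_ isT).
Qed.

(** Whether the two rails are on the same circle does not change along a bigon,
    nor across a blue rung, and they meet at the red rung [m]. *)
Lemma circle_rails t i m : (m < size (H i))%N -> t (rung i m).1 ->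
  forall n, (n < size (H i))%N ->
  circle t (inx (rung i n)) = circle t (inl (next_corner (rung i n))) /\
  circle t (inx (opposite (rung i n)))
  = circle t (inl (next_corner (opposite (rung i n)))).
Proof.
move=> m_lt t_m.
pose P n := circle t (inx (rung i n)) == circle t (inl (next_corner (rung i n))).
pose Q n := circle t (inx (opposite (rung i n)))
  == circle t (inl (next_corner (opposite (rung i n)))).
have PQ n : (n < size (H i))%N -> P n = Q n /\ (t (rung i n).1 -> P n).
  move=> n_lt; have n_odd := rung_odd n_lt.
  have on_odd : odd (opposite (rung i n)).2 by rewrite odd_opposite.
  have [n_red|n_blue] := boolP (t (rung i n).1).
    rewrite /P /Q -(circle_smooth t (inl (rung i n))) (smooth_red n_odd) //.
    rewrite -(circle_smooth t (inl (opposite (rung i n)))) (smooth_red on_odd) //.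
    by rewrite !eqxx.
  split=> //; rewrite /P /Q.
  rewrite -(circle_smooth t (inl (rung i n))) (smooth_blue n_odd) //.
  rewrite -[in RHS](circle_smooth t (inl (opposite (rung i n)))).
  by rewrite (smooth_blue on_odd) // oppositeK eq_sym.
have PS n : (n.+1 < size (H i))%N -> P n = P n.+1.
  move=> n_lt; have [-> _] := PQ _ n_lt; rewrite /P /Q.
  rewrite -(circle_edge t (inl (rung i n))) /= (join_rung n_lt).
  rewrite -[in RHS](circle_edge t (inl (opposite (rung i n.+1)))) /=.
  by rewrite (join_opposite_rung n_lt) eq_sym.
have P0 n : (n < size (H i))%N -> P n = P 0%N.
  by elim: n => // n IHn n_lt; rewrite -PS // IHn // ltnW.
move=> n n_lt; have Pn : P n.
  by rewrite P0 // -(P0 m) //; have [_ ->] := PQ m m_lt.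
have [PQn _] := PQ _ n_lt.
by split; apply/eqP; [exact: Pn|rewrite -/(Q n) -PQn].
Qed.

(** In a state where some rung of the ladder is red, all the darts of the gap
    [n] are on this circle, by [circle_rails]. *)
Definition gap_circle t i n : {set darts} :=
  if n is n'.+1 then circle t (inl (rung i n'))
  else circle t (inl (opposite (rung i 0))).

Lemma gap_circle_opposite t i m n : (m < size (H i))%N -> t (rung i m).1 ->
  (n < size (H i))%N -> circle t (inl (opposite (rung i n))) = gap_circle t i n.
Proof.
move=> m_lt t_m; case: n => //= n n_lt.
have [_ ->] := circle_rails m_lt t_m n_lt.
by rewrite -(join_rung n_lt) -[LHS](circle_edge) /= joinK.
Qed.

Lemma gap_circle_blue t i m n : (m < size (H i))%N -> t (rung i m).1 ->
  (n < size (H i))%N -> ~~ t (rung i n).1 ->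
  gap_circle t i n.+1 = gap_circle t i n.
Proof.
move=> m_lt t_m n_lt n_blue; rewrite -(gap_circle_opposite m_lt t_m n_lt) /=.
have [_ ->] := circle_rails m_lt t_m n_lt.
by rewrite -(smooth_blue (rung_odd n_lt) n_blue) circle_smooth.
Qed.

(** * The states s(M) *)

Implicit Types (M : steps_choice H).

Definition add_step M i n : steps_choice H :=
  [ffun l => [set m : 'I_(size (H l)) | (m \in M l) || (l == i) && (m == n :> nat)]].

Lemma mem_add_step M i n l (m : 'I_(size (H l))) :
  (m \in add_step M i n l) = (m \in M l) || (l == i) && (m == n :> nat).
Proof. by rewrite ffunE inE. Qed.

Lemma sM_step M i (m : 'I_(size (H i))) : sM s0 M (step m).1 = (m \in M i).
Proof.
rewrite ffunE step_rung (negPf (rung_blue (ltn_ord m))) /=.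
apply/existsP/idP => [[l /existsP[m' /andP[m'_M /eqP]]]|m_M].
  rewrite step_rung => /(rung_inj (ltn_ord m) (ltn_ord m'))[il].
  by case: l / il m' m'_M => m' m'_M /ord_inj ->.
by exists i; apply/existsP; exists m; rewrite m_M step_rung eqxx.
Qed.

Lemma sM_rung M i (m : 'I_(size (H i))) : sM s0 M (rung i m).1 = (m \in M i).
Proof. by rewrite -step_rung sM_step. Qed.

Lemma sM_old M x : s0 x -> sM s0 M x.
Proof. by rewrite ffunE => ->. Qed.

Lemma sM_inj M M' : sM s0 M = sM s0 M' -> M = M'.
Proof.
move=> e; apply/ffunP => i; apply/setP => m.
by rewrite -!sM_step e.
Qed.

Lemma sM_add_step M i (m : 'I_(size (H i))) :
  sM s0 (add_step M i m) = redden (sM s0 M) (step m).1.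
Proof.
apply/ffunP => x; rewrite [RHS]ffunE.
have [x_red|/blue_rung[l [m' ->]]] := boolP (s0 x).
  by rewrite !sM_old // orbT.
rewrite !sM_step mem_add_step orbC; congr orb.
apply/andP/eqP => [[/eqP il]|].
  by case: i / il m => m /eqP/ord_inj ->.
rewrite !step_rung => /(rung_inj (ltn_ord m') (ltn_ord m))[li mm].
by split; [rewrite li|rewrite mm].
Qed.

Lemma card_add_step M i (m : 'I_(size (H i))) l : m \notin M i ->
  #|add_step M i m l| = ((l == i) + #|M l|)%N.
Proof.
move=> mM; have [il|li] := eqVneq l i; last first.
  by apply: eq_card => m'; rewrite mem_add_step (negPf li) orbF.
subst l; rewrite /= (_ : add_step M i m i = m |: M i) ?cardsU1 ?mM //.
by apply/setP => m'; rewrite mem_add_step in_setU1 eqxx orbC.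
Qed.

Definition nonempty M : Prop := forall i, M i != set0.

Lemma nonempty_add_step M i n : nonempty M -> nonempty (add_step M i n).
Proof.
move=> M_gt l; have /set0Pn[m mM] := M_gt l.
by apply/set0Pn; exists m; rewrite mem_add_step mM.
Qed.

(** One of the two circles at a red step lies between it and another red step,
    hence in the inner gaps of the ladder. *)
Lemma red_step_split M i (m m' : 'I_(size (H i))) :
  m \in M i -> m' \in M i -> m != m' ->
  exists c : half_edge X, [/\ c.1 = (step m).1,
    circle (sM s0 M) (inl c) \subset interior i
  & circle (sM s0 M) (inl c) != circle (sM s0 M) (inl (opposite c))].
Proof.
move=> mM m'M mm'; have := mm'; rewrite neq_ltn => /orP[lt_mm'|lt_m'm].
  have [|||sub neq _ _] := @red_pair_split (sM s0 M) i m m'.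
  - by rewrite lt_mm' ltn_ord.
  - by rewrite sM_rung.
  - by rewrite sM_rung.
  by exists (rung i m); rewrite step_rung.
have [|||_ _ sub neq] := @red_pair_split (sM s0 M) i m' m.
- by rewrite lt_m'm ltn_ord.
- by rewrite sM_rung.
- by rewrite sM_rung.
by exists (opposite (rung i m)); rewrite step_rung oppositeK eq_sym.
Qed.

Lemma other_step M i (m : 'I_(size (H i))) : M i != set0 -> m \notin M i ->
  exists2 m', m' \in add_step M i m i & m != m'.
Proof.
case/set0Pn => m' m'M mM; exists m'; first by rewrite mem_add_step m'M.
by apply: contraNneq mM => ->.
Qed.

(** Blue crossings are steps of ladders which already have a red step. *)
Lemma all_split_sM M : nonempty M -> all_split (sM s0 M).
Proof.
move=> M_gt x x_blue; have : ~~ s0 x by apply: contra x_blue; apply: sM_old.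
case/blue_rung => i [m e]; rewrite e sM_step in x_blue *.
have [m' m'M mm'] := other_step (M_gt i) x_blue.
have mM : m \in add_step M i m i by rewrite mem_add_step !eqxx orbT.
have [c [c_m _ neq]] := red_step_split mM m'M mm'.
by rewrite -sM_add_step -c_m bichordE.
Qed.

Definition exterior (a : darts) : Prop := forall i, a \notin interior i.

(** Of the two circles created by a new red step of a broken ladder, one has no
    exterior dart; so nothing changes for the exterior darts. *)
Lemma exterior_add_step M i (m : 'I_(size (H i))) a b :
  nonempty M -> m \notin M i -> exterior a -> exterior b ->
  (circle (sM s0 (add_step M i m)) a == circle (sM s0 (add_step M i m)) b)
  = (circle (sM s0 M) a == circle (sM s0 M) b).
Proof.
move=> M_gt m_new a_ext b_ext.
have m_blue : ~~ sM s0 M (step m).1 by rewrite sM_step.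
have bi := all_split_sM M_gt m_blue.
have [m' m'M mm'] := other_step (M_gt i) m_new.
have mM : m \in add_step M i m i by rewrite mem_add_step !eqxx orbT.
have [c [c_m c_int _]] := red_step_split mM m'M mm'.
rewrite sM_add_step in c_int *; set t := redden _ _ in bi c_int *.
have ext u : exterior u -> u \notin circle t (inl c).
  by move=> u_ext; apply: contra (u_ext i); apply: (subsetP c_int).
have merged u : exterior u ->
    (u \in circle t (inl ((step m).1, 0)) :|: circle t (inl ((step m).1, 2)))
    = (u \in circle t (inl (opposite c))).
  move=> /ext/negPf u_c; rewrite in_setU -c_m.
  by case: (scar_ends t c) => -[-> ->]; rewrite u_c ?orbF.
apply/eqP/eqP => [/circle_eqP b_a|/circle_eqP b_a].
  by apply/circle_eqP; apply: (subsetP (circle_merge_sub m_blue bi a)).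
have [a_c|a_c] := boolP (a \in circle t (inl (opposite c))).
  have a_m := merged_circle_of m_blue bi; rewrite -/t in a_m.
  have {}a_m := a_m a; rewrite !merged // in a_m; move: b_a.
  rewrite a_m // merged // => b_c.
  by move/circle_eqP: a_c => <-; apply/circle_eqP.
by apply/circle_eqP; rewrite -(unmerged_circle m_blue bi) ?merged.
Qed.

Definition full_choice : steps_choice H := [ffun i => setT].

(** States with a red step in each ladder are compared with one another through
    the state where all the steps are red. *)
Lemma add_step_ind (P : steps_choice H -> Prop) :
  (forall M i (m : 'I_(size (H i))), nonempty M -> m \notin M i ->
     P (add_step M i m) -> P M) ->
  P full_choice -> forall M, nonempty M -> P M.
Proof.
move=> P_add P_full M; have [n] := ubnP (\sum_i #|~: M i|).
elim: n M => // n IHn M lt_n M_gt.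
have [/existsP[i /set0Pn[m]]|] := boolP [exists i, ~: M i != set0].
  rewrite inE => m_new; apply: (P_add _ _ _ M_gt m_new).
  apply: IHn; last exact: nonempty_add_step.
  rewrite -ltnS; apply: leq_trans _ lt_n; rewrite ltnS (bigD1 i) //= [X in (_ < X)%N](bigD1 i) //=.
  rewrite -addSn leq_add //.
    apply: proper_card; rewrite properE; apply/andP; split.
      by apply/subsetP => m'; rewrite !inE mem_add_step; case: (m' \in M i).
    apply/subsetPn; exists m; first by rewrite inE.
    by rewrite inE mem_add_step !eqxx orbT.
  apply: leq_sum => l _; apply: subset_leq_card; apply/subsetP => m'.
  by rewrite !inE mem_add_step; case: (m' \in M l).
rewrite negb_exists => /forallP M_full.
suff -> : M = full_choice by [].
apply/ffunP => i; rewrite ffunE; apply/setP => m; rewrite in_setT.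
by have := M_full i; rewrite negbK => /eqP/setP/(_ m); rewrite !inE => /negbFE.
Qed.

Lemma exterior_circles M M' a b : nonempty M -> nonempty M' ->
  exterior a -> exterior b ->
  (circle (sM s0 M) a == circle (sM s0 M) b)
  = (circle (sM s0 M') a == circle (sM s0 M') b).
Proof.
move=> M_gt M'_gt a_ext b_ext.
have full N : nonempty N -> (circle (sM s0 N) a == circle (sM s0 N) b)
    = (circle (sM s0 full_choice) a == circle (sM s0 full_choice) b).
  pose P (N' : steps_choice H) := (circle (sM s0 N') a == circle (sM s0 N') b)
    = (circle (sM s0 full_choice) a == circle (sM s0 full_choice) b).
  move=> N_gt; suff : P N by []; move: N N_gt.
  apply: (@add_step_ind P) => [N' i m N'_gt m_new|//].
  by rewrite /P => <-; apply/esym/exterior_add_step.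
by rewrite (full M M_gt) (full M' M'_gt).
Qed.

(** Applied to the number of red crossings and to the number of circles, this
    makes the degrees i and j of all the terms of V agree. *)
Lemma additive_count (f : kstate D -> nat) M M' :
  (forall s x, ~~ s x -> bichord (redden s x) x -> f (redden s x) = (f s).+1) ->
  nonempty M -> nonempty M' -> (forall i, #|M i| = #|M' i|) ->
  f (sM s0 M) = f (sM s0 M').
Proof.
move=> f_S M_gt M'_gt eq_M.
have count N : nonempty N ->
    (f (sM s0 N) + \sum_i size (H i) = f (sM s0 full_choice) + \sum_i #|N i|)%N.
  pose P (N' : steps_choice H) := (f (sM s0 N') + \sum_i size (H i)
    = f (sM s0 full_choice) + \sum_i #|N' i|)%N.
  move=> N_gt; suff : P N by []; move: N N_gt.
  apply: (@add_step_ind P) => [N' i m N'_gt m_new|]; rewrite /P.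
    have -> : (\sum_l #|add_step N' i m l| = (\sum_l #|N' l|).+1)%N.
      rewrite (eq_bigr _ (fun l _ => card_add_step l m_new)) big_split /=.
      by rewrite (bigD1 i) //= eqxx big1 => [|l /negPf -> //].
    rewrite sM_add_step f_S ?all_split_sM ?sM_step //; lia.
  by congr addn; apply: eq_bigr => i _; rewrite ffunE cardsT card_ord.
have := count _ M_gt; rewrite (eq_bigr _ (fun i _ => eq_M i)) -(count _ M'_gt).
exact: addIn.
Qed.

(** * The circles at the ends of a ladder *)

Lemma head_filter (T : Type) (x : T) (a : pred T) (r : seq T) :
  head x (filter a r) = nth x r (find a r).
Proof. by elim: r => //= y r IHr; case: ifP. Qed.

(** The rungs before the first red one are blue, so the periphery circle can be
    read at the end of the ladder, whichever steps are red. *)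
Lemma C0_gap M i : M i != set0 -> C0 cut (sM s0 M) i = gap_circle (sM s0 M) i 0.
Proof.
case/set0Pn => m mM; rewrite /C0 head_filter -/(rung i _).
set t := sM s0 M; set a := fun c : half_edge X => t c.1.
have a_H : has a (H i).
  by apply/(has_nthP (step (cut i))); exists m; rewrite // /a sM_rung.
have t_m : t (rung i m).1 by rewrite /t sM_rung.
rewrite (gap_circle_opposite (ltn_ord m) t_m) -?has_find //.
have : (find a (H i) <= find a (H i))%N by [].
elim: {1 3}(find a (H i)) => // n IHn n_lt.
rewrite (gap_circle_blue (ltn_ord m) t_m) ?IHn ?(ltnW n_lt) //.
  by apply: leq_trans n_lt _; apply: find_size.
by apply/negbT/(before_find (step (cut i)) n_lt).
Qed.

Lemma exterior_first i : exterior (inl (opposite (rung i 0))).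
Proof.
move=> l; have h_gt : (0 < size (H i))%N by apply: leq_ltn_trans (ltn_ord (cut i)).
have [->|li] := eqVneq l i; first by rewrite opposite_rung_between.
by apply: (other_ladder_between _ _ _ h_gt); rewrite // eq_sym.
Qed.

Lemma exterior_last i : exterior (inl (rung i (size (H i)).-1)).
Proof.
move=> l; have h_gt : (0 < size (H i))%N by apply: leq_ltn_trans (ltn_ord (cut i)).
have h_lt : ((size (H i)).-1 < size (H i))%N by rewrite prednK.
have [->|li] := eqVneq l i; first by rewrite rung_between //; lia.
by apply: (other_ladder_between _ _ _ h_lt); rewrite // eq_sym.
Qed.

Lemma exterior_red (c : half_edge X) : s0 c.1 -> exterior (inl c).
Proof. by move=> c_red i; apply: red_between. Qed.

Definition cut_choice : steps_choice H := [ffun i => [set cut i]].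

Lemma s1_sM : s1 s0 cut = sM s0 cut_choice.
Proof.
apply/ffunP => x; rewrite !ffunE; congr orb; apply: eq_existsb => i.
apply/eqP/existsP => [->|[m /andP[+ /eqP ->]]].
  by exists (cut i); rewrite ffunE inE !eqxx.
by rewrite ffunE inE => /eqP ->.
Qed.

Lemma nonempty_cut : nonempty cut_choice.
Proof. by move=> i; apply/set0Pn; exists (cut i); rewrite ffunE inE. Qed.

(** Both ends of the ladder are exterior, so whether they are on the same circle
    may be checked in [s1]. *)
Lemma periphery_one_gap M i : nonempty M -> periphery_number s0 cut i = 1%N ->
  gap_circle (sM s0 M) i (size (H i)) = gap_circle (sM s0 M) i 0.
Proof.
move=> M_gt; rewrite /periphery_number cards2 s1_sM -nth0 -nth_last -!/(rung i _).
have h_gt : (0 < size (H i))%N by apply: leq_ltn_trans (ltn_ord (cut i)).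
case: eqP => // e _; rewrite -(prednK h_gt) /=; apply/esym/eqP.
rewrite (exterior_circles M_gt nonempty_cut (exterior_first i) (exterior_last i)).
exact/eqP.
Qed.

Lemma old_red_bichord M x : nonempty M ->
  s0 x -> bichord (s1 s0 cut) x -> bichord (sM s0 M) x.
Proof.
move=> M_gt x_red; rewrite /bichord s1_sM; apply: contra => bi.
have ext z : exterior (inl (x, z)) := @exterior_red (x, z) x_red.
by rewrite (exterior_circles nonempty_cut M_gt (ext _) (ext _)).
Qed.

Lemma red_bichord M x : (forall i, 2 <= #|M i|)%N ->
  (forall y, s0 y -> bichord (s1 s0 cut) y) -> sM s0 M x -> bichord (sM s0 M) x.
Proof.
move=> M_gt bi; have M_ne : nonempty M.
  by move=> i; rewrite -card_gt0; apply: leq_trans (M_gt i).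
have [x_red _|x_blue] := boolP (s0 x).
  by apply: old_red_bichord M_ne x_red (bi x x_red).
have [i [m ->]] := blue_rung x_blue; rewrite sM_step => mM.
have : (0 < #|M i :\ m|)%N by move: (M_gt i); rewrite (cardsD1 m) mM.
case/card_gt0P => m'; rewrite in_setD1 => /andP[m'm m'M].
have [|c [<- _ neq]] := red_step_split mM m'M; first by rewrite eq_sym.
by rewrite bichordE.
Qed.

(** * Signs and telescoping *)

Variable num : seq X.
Hypothesis ladders_first : prefix (ladder_crossings H) num.

Lemma rung_in_ladder_crossings i n : (n < size (H i))%N ->
  (rung i n).1 \in ladder_crossings H.
Proof. by move=> n_lt; rewrite -index_mem index_ladder_crossings ?flatten_index_lt. Qed.

Lemma index_num_rung i l n p : (n < size (H i))%N -> (p < size (H l))%N ->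
  (index (rung l p).1 num < index (rung i n).1 num)%N
  = (l < i)%N || (l == i) && (p < n)%N.
Proof.
move=> n_lt p_lt; have /prefixP[r ->] := ladders_first.
rewrite !index_cat !rung_in_ladder_crossings // !index_ladder_crossings //.
exact: flatten_index_mono.
Qed.

Lemma index_num_red i n x : (n < size (H i))%N -> s0 x ->
  (index x num < index (rung i n).1 num)%N = false.
Proof.
move=> n_lt x_red; have /prefixP[r ->] := ladders_first.
rewrite !index_cat rung_in_ladder_crossings // index_ladder_crossings //.
have -> : (x \in ladder_crossings H) = false.
  by case: H_grouped => _ /perm_mem ->; rewrite mem_enum; apply/negbTE; rewrite negbK.
apply/negbTE; rewrite -leqNgt; apply: (leq_trans (ltnW (flatten_index_lt n_lt))).
exact: leq_addr.
Qed.

Lemma card_choice M i : #|M i| = (\sum_(n < size (H i)) sM s0 M (rung i n).1)%N.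
Proof.
rewrite -sum1_card big_mkcond; apply: eq_bigr => m _.
by rewrite sM_rung; case: (m \in M i).
Qed.

Lemma nb_before_sM M i n : (n < size (H i))%N ->
  nb_before num (rung i n).1 (sM s0 M)
  = (\sum_(l < k | (l < i)%N) #|M l| + \sum_(j < n) sM s0 M (rung i j).1)%N.
Proof.
move=> n_lt; rewrite /nb_before -sum1_card.
pose F (y : X) : nat := sM s0 M y && (index y num < index (rung i n).1 num)%N.
transitivity (\sum_(y | ~~ s0 y) F y)%N.
  rewrite big_mkcond [RHS]big_mkcond; apply: eq_bigr => y _.
  rewrite inE /F; have [y_red|_] := boolP (s0 y).
    by rewrite (index_num_red n_lt y_red) andbF.
  by rewrite -[LHS]/(nat_of_bool (_ && _)).
rewrite big_blue (bigID (fun l : 'I_k => (l < i)%N)) /=; congr addn.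
  apply: eq_bigr => l li; rewrite card_choice; apply: eq_bigr => m _.
  by rewrite /F step_rung index_num_rung // li andbT.
rewrite (bigD1 i) ?ltnn //= [X in (_ + X)%N]big1 ?addn0 => [|l /andP[il li]].
  rewrite (big_ord_widen _ (fun j => nat_of_bool (sM s0 M (rung i j).1)) (ltnW n_lt)).
  rewrite [RHS]big_mkcond; apply: eq_bigr => m _.
  rewrite /F step_rung index_num_rung // ltnn eqxx /=.
  by case: (m < n)%N; rewrite ?andbT ?andbF.
rewrite big1 // => m _.
by rewrite /F step_rung index_num_rung // (negPf il) (negPf li) /= andbF.
Qed.

Lemma nb_before_redden s x : nb_before num x (redden s x) = nb_before num x s.
Proof.
rewrite /nb_before; apply: eq_card => y; rewrite !inE ffunE.
by have [->|//] := eqVneq y x; rewrite ltnn !andbF.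
Qed.

(** The signs of consecutive indices satisfying [p] alternate and [g] is constant
    between them, so the terms cancel in pairs. *)
Lemma telescope_signs (Z : zmodType) (g : nat -> Z) (p : pred nat) (h : nat) :
  (forall n, (n < h)%N -> ~~ p n -> g n.+1 = g n) ->
  \sum_(n < h | p n) (g n + g n.+1) *~ (-1) ^+ (\sum_(j < n) p j)%N
  = g 0%N - g h *~ (-1) ^+ (\sum_(j < h) p j)%N.
Proof.
elim: h => [|h IHh] g_eq; first by rewrite !big_ord0 expr0 mulr1z subrr.
rewrite big_mkcond big_ord_recr /= -big_mkcond IHh; last first.
  by move=> n n_lt; apply: g_eq; apply: leqW.
rewrite [in RHS]big_ord_recr /=; case: (boolP (p h)) => p_h.
  rewrite addn1 exprS mulN1r mulrNz opprK mulrzDl.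
  by rewrite addrA subrK.
by rewrite addn0 addr0 (g_eq h).
Qed.

(** Two consecutive red steps share the intermediate circle between them, which
    occurs once with each sign; the circles at the two ends remain. *)
Lemma ladder_telescope (Z : zmodType) (Phi : {set darts} -> Z) M i :
  M i != set0 ->
  \sum_(m in M i) (Phi (circle (sM s0 M) (inl (step m)))
                   + Phi (circle (sM s0 M) (inl (opposite (step m)))))
                  *~ (-1) ^+ (\sum_(j < m) sM s0 M (rung i j).1)%N
  = Phi (gap_circle (sM s0 M) i 0)
    - Phi (gap_circle (sM s0 M) i (size (H i))) *~ (-1) ^+ #|M i|.
Proof.
case/set0Pn => m0 m0M; set t := sM s0 M.
have t_m0 : t (rung i m0).1 by rewrite /t sM_rung.
rewrite card_choice -(@telescope_signs _ (fun n => Phi (gap_circle t i n))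
                                         (fun n => t (rung i n).1)).
  apply: eq_big => [m|m mM]; first by rewrite /t sM_rung.
  rewrite step_rung addrC (gap_circle_opposite (ltn_ord m0) t_m0 (ltn_ord m)).
  by [].
by move=> n n_lt n_blue; rewrite (gap_circle_blue (ltn_ord m0) t_m0).
Qed.

Definition has_sizes (nu : 'I_k -> nat) M : bool := [forall l, #|M l| == nu l].

Definition remove_step M i n : steps_choice H :=
  [ffun l => [set m : 'I_(size (H l)) | (m \in M l) && ~~ ((l == i) && (m == n :> nat))]].

Lemma mem_remove_step M i n l (m : 'I_(size (H l))) :
  (m \in remove_step M i n l) = (m \in M l) && ~~ ((l == i) && (m == n :> nat)).
Proof. by rewrite ffunE inE. Qed.

Lemma remove_stepK M i (m : 'I_(size (H i))) :
  m \in M i -> add_step (remove_step M i m) i m = M.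
Proof.
move=> mM; apply/ffunP => l; apply/setP => m'.
rewrite mem_add_step mem_remove_step orb_andl orNb andbT.
apply: orb_idr => /andP[/eqP li]; subst l.
by move=> /eqP/ord_inj ->.
Qed.

Lemma add_stepK M i (m : 'I_(size (H i))) :
  (remove_step (add_step M i m) i m == M) = (m \notin M i).
Proof.
apply/eqP/idP => [<-|mM]; first by rewrite mem_remove_step !eqxx andbF.
apply/ffunP => l; apply/setP => m'; rewrite mem_remove_step mem_add_step.
rewrite andb_orl andbN orbF; apply: andb_idr => m'M; apply: contra mM.
by case/andP => /eqP li; subst l => /eqP/ord_inj <-.
Qed.

Lemma sum_add_step (Z : nmodType) (K : steps_choice H -> Z) nu i (m : 'I_(size (H i))) :
  \sum_(M | has_sizes nu M && (m \notin M i)) K (add_step M i m)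
  = \sum_(M | has_sizes (fun l => (l == i) + nu l)%N M && (m \in M i)) K M.
Proof.
rewrite [RHS](reindex_onto (fun M => add_step M i m) (fun M => remove_step M i m)) /=.
  apply: eq_bigl => M; rewrite add_stepK mem_add_step !eqxx orbT andbT.
  have [mM|mM] := boolP (m \in M i); first by rewrite !andbF.
  rewrite !andbT; apply: eq_forallb => l.
  by rewrite card_add_step // eqn_add2l.
by move=> M /andP[_]; apply: remove_stepK.
Qed.

(** The computation common to the differentials of the all-plus states and of V:
    the terms are grouped by the ladder of the step that changes and by the
    resulting state, then telescoped along that ladder. *)
Lemma sum_over_steps (Z : zmodType) (Phi : kstate D -> {set darts} -> Z) nu :
  (forall i, 0 < nu i)%N ->
  \sum_(M | has_sizes nu M) \sum_(x | ~~ sM s0 M x)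
    (Phi (redden (sM s0 M) x) (circle (redden (sM s0 M) x) (inl (x, 0)))
     + Phi (redden (sM s0 M) x) (circle (redden (sM s0 M) x) (inl (x, 2))))
    *~ (-1) ^+ nb_before num x (sM s0 M)
  = \sum_i (\sum_(M | has_sizes (fun l => (l == i) + nu l)%N M)
      (Phi (sM s0 M) (gap_circle (sM s0 M) i 0)
       + Phi (sM s0 M) (gap_circle (sM s0 M) i (size (H i))) *~ (-1) ^+ nu i))
      *~ (-1) ^+ (\sum_(l < k | (l < i)%N) nu l)%N.
Proof.
move=> nu_gt.
pose F t x : Z := (Phi t (circle t (inl (x, 0))) + Phi t (circle t (inl (x, 2))))
    *~ (-1) ^+ nb_before num x t.
transitivity (\sum_(M | has_sizes nu M) \sum_i \sum_(m < size (H i) | m \notin M i)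
   F (sM s0 (add_step M i m)) (step m).1).
  apply: eq_bigr => M _.
  transitivity (\sum_(x | ~~ s0 x) if sM s0 M x then 0 else F (redden (sM s0 M) x) x).
    rewrite big_mkcond [RHS]big_mkcond; apply: eq_bigr => x _.
    have [x_red|x_blue] := boolP (s0 x); first by rewrite sM_old.
    by case: (sM s0 M x); rewrite //= /F nb_before_redden.
  rewrite big_blue; apply: eq_bigr => i _; rewrite [RHS]big_mkcond.
  apply: eq_bigr => m _; rewrite sM_step sM_add_step.
  by case: (m \in M i).
rewrite exchange_big; apply: eq_bigr => i _.
transitivity (\sum_(m < size (H i)) \sum_(M | has_sizes nu M && (m \notin M i))
   F (sM s0 (add_step M i m)) (step m).1).
  rewrite (exchange_big_dep xpredT) //=.
transitivity (\sum_(m < size (H i))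
  \sum_(M | has_sizes (fun l => (l == i) + nu l)%N M && (m \in M i)) F (sM s0 M) (step m).1).
  by apply: eq_bigr => m _; apply: (sum_add_step (fun M => F (sM s0 M) (step m).1)).
rewrite mulrz_suml (exchange_big_dep (has_sizes (fun l => (l == i) + nu l)%N)) /=; last first.
  by move=> m M _ /andP[].
apply: eq_bigr => M /forallP M_nu.
have M_i : #|M i| = (nu i).+1 by have /eqP -> := M_nu i; rewrite eqxx.
have M_gt : M i != set0 by rewrite -card_gt0 M_i.
have := ladder_telescope (Phi (sM s0 M)) M_gt.
rewrite M_i exprS mulN1r mulrNz opprK => <-.
rewrite mulrz_suml; apply: eq_big => [m|m mM].
  by case: (m \in M i); rewrite ?andbT ?andbF //; apply/forallP.
rewrite /F step_rung nb_before_sM // exprD mulrC mulrzA.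
have -> : (\sum_(l < k | (l < i)%N) #|M l| = \sum_(l < k | (l < i)%N) nu l)%N.
  apply: eq_bigr => l li; have /eqP -> := M_nu l.
  by case: eqP li => // ->; rewrite ltnn.
congr (_ *~ _ *~ _).
by case: (scar_ends (sM s0 M) (rung i m)) => -[-> ->]; rewrite // addrC.
Qed.

(** * The differentials of the all-plus sum and of V *)

Lemma has_sizes_le nu M : has_sizes nu M -> forall i, (nu i <= size (H i))%N.
Proof.
move=> /forallP M_nu i; have /eqP <- := M_nu i.
by rewrite -[X in (_ <= X)%N]card_ord max_card.
Qed.

Lemma has_sizes_nonempty nu M : (forall i, 0 < nu i)%N -> has_sizes nu M -> nonempty M.
Proof. by move=> nu_gt /forallP M_nu i; rewrite -card_gt0 (eqP (M_nu i)). Qed.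

Lemma has_sizes_exists nu : (forall i, nu i <= size (H i))%N ->
  exists M, has_sizes nu M.
Proof.
move=> nu_le; exists [ffun i => [set m : 'I_(size (H i)) | (m < nu i)%N]].
apply/forallP => i; rewrite ffunE -sum1_card.
rewrite (eq_bigl (fun m : 'I_(size (H i)) => (m < nu i)%N)); last first.
  by move=> m; rewrite inE.
by rewrite -(big_ord_widen _ (fun=> 1%N)) // sum1_card card_ord.
Qed.

Definition sign_before (nu : 'I_k -> nat) i : int :=
  (-1) ^+ (\sum_(l < k | (l < i)%N) nu l)%N.

(** When the circles at the two ends agree, the factor 1 + (-1)^nu_i is 2 or 0.
    If the ends may differ, all the steps of the ladder are already red, and no
    choice has one more. *)
Lemma sum_over_steps_periphery (Z : zmodType) (Phi : kstate D -> {set darts} -> Z) nu :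
  (forall i, 0 < nu i)%N ->
  (forall i, nu i < size (H i) -> periphery_number s0 cut i = 1)%N ->
  \sum_(M | has_sizes nu M) \sum_(x | ~~ sM s0 M x)
    (Phi (redden (sM s0 M) x) (circle (redden (sM s0 M) x) (inl (x, 0)))
     + Phi (redden (sM s0 M) x) (circle (redden (sM s0 M) x) (inl (x, 2))))
    *~ (-1) ^+ nb_before num x (sM s0 M)
  = \sum_(i | ~~ odd (nu i) && (nu i < size (H i))%N)
      (\sum_(M | has_sizes (fun l => (l == i) + nu l)%N M)
        Phi (sM s0 M) (gap_circle (sM s0 M) i 0)) *~ sign_before nu i *+ 2.
Proof.
move=> nu_gt nu_one; rewrite sum_over_steps // [RHS]big_mkcond.
apply: eq_bigr => i _; have [i_lt|i_ge] := ltnP (nu i) (size (H i)); last first.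
  rewrite andbF big1 ?mul0rz // => M /has_sizes_le/(_ i).
  by rewrite eqxx ltnNge i_ge.
rewrite andbT -/(sign_before nu i).
rewrite (eq_bigr (fun M => Phi (sM s0 M) (gap_circle (sM s0 M) i 0)
  *~ (1 + (-1) ^+ nu i))) => [|M M_nu].
  rewrite -mulrz_suml -signr_odd; case: (odd (nu i)) => /=.
    by rewrite expr1 subrr mulr0z mul0rz.
  by rewrite expr0 mulrzAC -[1 + 1]/(2%:Z) -pmulrn.
rewrite mulrzDr mulr1z; congr (_ + Phi _ _ *~ _).
apply: periphery_one_gap (nu_one _ i_lt).
by apply: has_sizes_nonempty M_nu => l; rewrite addn_gt0 nu_gt orbT.
Qed.

Variable mu : 'I_k -> nat.
Hypothesis mu_bounds : forall i, (2 <= mu i <= size (H i))%N.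
Hypothesis mu_periphery :
  forall i, (mu i < size (H i))%N -> periphery_number s0 cut i = 1%N.

Let mu_gt i : (0 < mu i)%N.
Proof. by case/andP: (mu_bounds i) => /ltnW. Qed.

Let mu1_gt i l : (0 < (l == i) + mu l)%N.
Proof. by rewrite addn_gt0 mu_gt orbT. Qed.

Definition all_plus_sum : chain D :=
  \sum_(M | has_sizes mu M) generator (sM s0 M) (circles (sM s0 M)).

Lemma s_minusE i : s_minus s0 cut (fun l => (l == i) + mu l)%N i
  = \sum_(M | has_sizes (fun l => (l == i) + mu l)%N M)
      minus1 (sM s0 M) (gap_circle (sM s0 M) i 0).
Proof.
apply: eq_bigr => M M_mu; rewrite C0_gap //.
exact: has_sizes_nonempty (mu1_gt i) M_mu i.
Qed.

Lemma diff_all_plus_sum : diff num all_plus_sum = V s0 cut mu *+ 2.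
Proof.
have E := sum_over_steps_periphery (@minus1 D) mu_gt mu_periphery.
rewrite /all_plus_sum raddf_sum /V -sumrMnl; apply: etrans (etrans _ E) _.
  apply: eq_bigr => M M_mu; apply: diff_all_plus.
  exact/all_split_sM/(has_sizes_nonempty mu_gt M_mu).
by apply: eq_bigr => i _; rewrite s_minusE.
Qed.

Definition minus2_sum i l : chain D :=
  \sum_(M | has_sizes (fun j => (j == l) + ((j == i) + mu j))%N M)
     minus2 (sM s0 M) (gap_circle (sM s0 M) i 0) (gap_circle (sM s0 M) l 0).

Lemma minus2_sumC i l : minus2_sum i l = minus2_sum l i.
Proof.
apply: eq_big => [M|M _]; last exact: minus2C.
by apply: eq_forallb => j; rewrite addnCA.
Qed.

Lemma minus2_sum_id i : minus2_sum i i = 0.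
Proof. by apply: big1 => M _; apply: minus2_id. Qed.

Lemma sign_before_add i l : sign_before (fun j => (j == i) + mu j)%N l
  = (-1) ^+ (i < l)%N * sign_before mu l.
Proof.
rewrite /sign_before big_split exprD /=; congr (_ ^+ _ * _).
rewrite big_mkcond (bigD1 i) //= eqxx big1 => [|j /negPf ->]; last by rewrite if_same.
by case: (i < l)%N.
Qed.

(** Making an additional red step first in the ladder i and then in the ladder l,
    or the other way round, gives the same states with minus signs on C_i^0 and
    C_l^0.  The first change adds one red crossing before those of the later
    ladder, so the two contributions have opposite signs. *)
Lemma diff_V : diff num (V s0 cut mu) = 0.
Proof.
pose c i := ~~ odd (mu i) && (mu i < size (H i))%N.
pose f i l : chain D := minus2_sum i l
  *~ ((-1) ^+ (i < l)%N * sign_before mu l * sign_before mu i).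
suff -> : diff num (V s0 cut mu) = (\sum_(i | c i) \sum_(l | c l) f i l) *+ 2.
  (* The double sum is its own opposite, by exchanging [i] and [l]. *)
  apply/eqP; rewrite mulr2n -[X in _ + X]opprK subr_eq0; apply/eqP.
  rewrite {1}exchange_big -sumrN; apply: eq_bigr => i _; rewrite -sumrN.
  apply: eq_bigr => l _; rewrite /f; have [->|il] := eqVneq i l.
    by rewrite minus2_sum_id !mul0rz oppr0.
  rewrite minus2_sumC -mulrNz; congr (_ *~ _); rewrite mulrAC -!mulNr.
  by congr (_ * _ * _); case: ltngtP il => // /val_inj ->; rewrite eqxx.
rewrite /V raddf_sum /= -sumrMnl; apply: eq_bigr => i i_c.
rewrite raddfMz s_minusE raddf_sum /=.
have nu_periphery l : ((l == i) + mu l < size (H l))%N ->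
    periphery_number s0 cut l = 1%N.
  by move=> l_lt; apply: mu_periphery; apply: leq_ltn_trans l_lt; apply: leq_addl.
have E := sum_over_steps_periphery (fun t => minus2 t (gap_circle t i 0))
  (mu1_gt i) nu_periphery.
rewrite -sumrMnl; apply: etrans (congr1 (fun c => c *~ _) (etrans _ E)) _.
  apply: eq_bigr => M M_mu; apply: diff_minus1.
  exact/all_split_sM/(has_sizes_nonempty (mu1_gt i) M_mu).
rewrite mulrz_suml [LHS]big_mkcond [RHS]big_mkcond; apply: eq_bigr => l _.
have [->|li] := eqVneq l i.
  rewrite /f minus2_sum_id mul0rz mul0rn if_same; case: ifP => // _.
  by rewrite [X in X *~ _ *+ 2](minus2_sum_id i) mul0rz mul0rn mul0rz.
rewrite add0n -/(c l); case: (c l) => //.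
rewrite -/(minus2_sum i l) /f sign_before_add !pmulrn.
by rewrite [in RHS]mulrzA mulrzAC.
Qed.

(** * The class of V *)

Hypothesis old_red : forall x, s0 x -> bichord (s1 s0 cut) x.
Variable r : 'I_k.
Hypothesis mu_r_even : ~~ odd (mu r).
Hypothesis mu_r_lt : (mu r < size (H r))%N.

(** Over a state [sM s0 M0] with one more red step in the ladder r, the chain V
    has a single term, with coefficient 1 or -1 and one minus sign: the count
    is odd there. *)
Lemma V_not_boundary c : diff num c <> V s0 cut mu.
Proof.
have [M0 M0_mu] : exists M, has_sizes (fun l => (l == r) + mu l)%N M.
  apply: has_sizes_exists => l; have [->|_] := eqVneq l r; first exact: mu_r_lt.
  by case/andP: (mu_bounds l).
move=> dc; have : (2 %| minus1_count (sM s0 M0) (V s0 cut mu))%Z.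
  rewrite -dc; apply: minus1_count_diff => x; apply: red_bichord => // i.
  have /eqP -> := forallP M0_mu i; case/andP: (mu_bounds i) => mu_i _.
  exact: leq_trans mu_i (leq_addl _ _).
(* The sizes of [M0] single out the ladder [r]. *)
have count i : minus1_count (sM s0 M0) (s_minus s0 cut (fun l => (l == i) + mu l)%N i)
    = (i == r)%:R.
  rewrite s_minusE raddf_sum /=; have [->|ir] := eqVneq i r.
    rewrite (bigD1 M0) //= big1 => [|M /andP[_ M_M0]].
      by rewrite minus1_count_generator ?imset_f // eqxx addr0.
    rewrite minus1_count_generator ?imset_f //.
    by case: eqP => // /sM_inj e; rewrite e eqxx in M_M0.
  apply: big1 => M M_mu; rewrite minus1_count_generator ?imset_f //.
  case: eqP => // /sM_inj e; rewrite {}e in M_mu.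
  have /eqP := forallP M_mu r; have /eqP -> := forallP M0_mu r.
  by rewrite eqxx [r == i]eq_sym (negPf ir) add1n => /esym/n_Sn.
have -> : minus1_count (sM s0 M0) (V s0 cut mu)
    = \sum_(i | ~~ odd (mu i) && (mu i < size (H i))%N) (i == r)%:R *~ sign_before mu i.
  rewrite raddf_sum; apply: eq_bigr => i _.
  by rewrite raddfMz; congr (_ *~ _); apply: count.
rewrite (bigD1 r) ?mu_r_even //= [X in _ + X]big1 => [|i /andP[_ /negPf ->]]; last first.
  exact: mul0rz.
by rewrite eqxx addr0 intz dvdzE abszX exp1n.
Qed.

Lemma in_degree_diff (i j : int) (c : chain D) :
  in_degree i j c -> in_degree (i + 1) j (diff num c).
Proof.
move=> /forallP c_ij; apply/forallP => f; apply/implyP; apply: contraNT => f_ij.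
rewrite ffunE; apply/eqP/big1 => x _; apply: big1 => e /and5P[_ _ /eqP ef_i /eqP ef_j _].
have [->|/(implyP (c_ij e)) /andP[/eqP e_i /eqP e_j]] := eqVneq (c e) 0; first by rewrite mulr0.
by case/negP: f_ij; rewrite ef_i ef_j e_i e_j !eqxx.
Qed.

Lemma all_plus_sum_degree : exists i j : int, in_degree i j all_plus_sum.
Proof.
have [M0 M0_mu] : exists M, has_sizes mu M.
  by apply: has_sizes_exists => l; case/andP: (mu_bounds l).
exists #|[set x | sM s0 M0 x]|%:Z, (#|[set x | sM s0 M0 x]|%:Z + #|circles (sM s0 M0)|%:Z).
apply/forallP => f; apply/implyP; rewrite chain_sumE => f_neq0.
have [M M_mu] : exists2 M, has_sizes mu M & val f = (sM s0 M, circles (sM s0 M)).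
  have [/existsP[M /andP[M_mu /eqP fM]]|none] :=
    boolP [exists M, has_sizes mu M && (val f == (sM s0 M, circles (sM s0 M)))].
    by exists M.
  case/eqP: f_neq0; apply: big1 => M M_mu; rewrite ffunE.
  by case: eqP => // fM; case/existsP: none; exists M; rewrite M_mu fM eqxx.
move/eqP; rewrite estate_eqE => /andP[/eqP f_t /eqP f_P].
have same_size l : #|M l| = #|M0 l|.
  by rewrite (eqP (forallP M_mu l)) (eqP (forallP M0_mu l)).
have M_gt := has_sizes_nonempty mu_gt M_mu; have M0_gt := has_sizes_nonempty mu_gt M0_mu.
rewrite /jdeg thetaE /ideg f_t f_P.
have -> : #|[set x | sM s0 M x]| = #|[set x | sM s0 M0 x]|.
  apply: (additive_count (f := fun t => #|[set x | t x]|)) => //.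
  by move=> s x s_x _; apply: card_redden.
have -> : #|circles (sM s0 M)| = #|circles (sM s0 M0)|.
  apply: (additive_count (f := fun t => #|circles t|)) => //.
  by move=> s x; apply: card_circles_merge.
by rewrite addrK !eqxx.
Qed.

(** Since 2 V is the differential of the all-plus sum, and chains have integer
    coefficients, the degree of V follows from that of this sum. *)
Lemma V_degree (i j : int) : in_degree i j all_plus_sum -> in_degree (i + 1) j (V s0 cut mu).
Proof.
move=> /in_degree_diff; rewrite diff_all_plus_sum => /forallP V_ij.
apply/forallP => f; apply/implyP => V_f; apply: (implyP (V_ij f)).
by rewrite ffunMnE mulrn_eq0.
Qed.

Lemma order_two_class : exists (i j : int) (z : cycles num i j),
  cycle_chain z = V s0 cut mu /\ order_two (hclass z).
Proof.
have [i [j W_ij]] := all_plus_sum_degree.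
have V_cycle : V s0 cut mu \in cycle_pred num (i + 1) j.
  by rewrite inE V_degree //= diff_V.
exists (i + 1), j, (Cycle V_cycle); split=> //; split.
  rewrite hclass_eq0; apply/asboolP => -[c _ dc].
  exact: (V_not_boundary dc).
rewrite -hclassMn; apply/eqP; rewrite hclass_eq0; apply/asboolP.
exists all_plus_sum; first by rewrite addrK.
by rewrite diff_all_plus_sum.
Qed.

End Ladders.

Lemma order_two_class_Kh (D : diagram) (s0 : kstate D) (k : nat)
    (H : 'I_k -> seq (half_edge (crossing D))) (H_grouped : grouped s0 H)
    (cut : forall i, 'I_(size (H i))) (num : seq (crossing D)) (mu : 'I_k -> nat)
    (r : 'I_k) :
  prefix (ladder_crossings H) num ->
  (forall i, 2 <= mu i <= size (H i))%N ->
  (forall i, mu i < size (H i) -> periphery_number s0 cut i = 1)%N ->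
  (forall x, s0 x -> bichord (s1 s0 cut) x) ->
  ~~ odd (mu r) -> (mu r < size (H r))%N ->
  exists (h q : int)
         (z : cycles num (h + (n_negative D)%:Z)
                         (q - (n_positive D)%:Z + 2 * (n_negative D)%:Z)),
    cycle_chain z = V s0 cut mu /\ order_two (hclass z : Kh num h q).
Proof.
move=> first mu_b mu_p old_red r_even r_lt.
have [i [j z_ij]] := order_two_class H_grouped first mu_b mu_p old_red r_even r_lt.
exists (i - (n_negative D)%:Z), (j + (n_positive D)%:Z - 2 * (n_negative D)%:Z).
rewrite /Kh subrK.
have -> : j + (n_positive D)%:Z - 2 * (n_negative D)%:Z - (n_positive D)%:Z
  + 2 * (n_negative D)%:Z = j by lia.
exact: z_ij.
Qed.

Theorem corollary10
  (D : diagram)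
  (s0 : kstate D) (k : nat) (H : 'I_k -> seq (half_edge (crossing D)))
  (Hgrouped : grouped s0 H)
  (Hheight : forall i : 'I_k, (2 <= size (H i))%N)
  (num : seq (crossing D))
  (Hnum : perm_eq num (enum (crossing D)))
  (Hladders_first : prefix (ladder_crossings H) num)
  (cut : forall i : 'I_k, 'I_(size (H i)))
  (Hperiphery_one : exists l : 'I_k,
     periphery_number s0 cut l = 1%N /\ (3 <= size (H l))%N)
  (Hbichord : forall x : crossing D, s0 x -> bichord (s1 s0 cut) x) :
  (exists (h q : int) (x : Kh num h q), order_two x) /\
  (forall (t : nat) (mu : 'I_k -> nat),
     (t <= k)%N ->
     (forall i : 'I_k, periphery_number s0 cut i = 1%N <-> (i < t)%N) ->
     (forall i : 'I_k, (i < t)%N -> (2 <= mu i <= size (H i))%N) ->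
     (exists r : 'I_k, [/\ (r < t)%N, ~~ odd (mu r) & (mu r < size (H r))%N]) ->
     (forall i : 'I_k, (t <= i)%N -> mu i = size (H i)) ->
     exists (h q : int)
            (z : cycles num (h + (n_negative D)%:Z)
                            (q - (n_positive D)%:Z + 2 * (n_negative D)%:Z)),
       cycle_chain z = V s0 cut mu /\ order_two (hclass z : Kh num h q)).
Proof.
split=> [|t mu _ periphery_t mu_t [r [_ r_even r_lt]] mu_rest].
  (* One more red step fits in [H l], as its height is at least 3. *)
  have [l [l_one l_ge3]] := Hperiphery_one.
  pose mu i := if i == l then 2 else size (H i).
  have mu_bounds i : (2 <= mu i <= size (H i))%N.
    by rewrite /mu; case: eqP => [->|_]; rewrite ?Hheight ?leqnn.
  have mu_one i : (mu i < size (H i))%N -> periphery_number s0 cut i = 1%N.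
    by rewrite /mu; case: eqP => [->|_]; rewrite ?ltnn.
  have [||h [q [z [_ z2]]]] := @order_two_class_Kh _ _ _ _ Hgrouped cut num mu l
    Hladders_first mu_bounds mu_one Hbichord.
  - by rewrite /mu eqxx.
  - by rewrite /mu eqxx.
  by exists h, q, (hclass z).
apply: (@order_two_class_Kh _ _ _ _ Hgrouped cut num mu r) => // i.
  by have [/mu_t//|/mu_rest ->] := ltnP i t; rewrite Hheight leqnn.
move=> i_lt; apply/periphery_t; rewrite ltnNge.
by apply: contraTN i_lt => /mu_rest ->; rewrite ltnn.
Qed.
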